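(* (i) There are measurable functions $f_1(s)$ and $f_2(s)$ on $(0,\infty)$ with identical $\tau$-measure such that $\mathfrak D(\Phi_{f_1})\neq\mathfrak D(\Phi_{f_2})$. (ii) There are measurable functions $f_1(s)$ and $f_2(s)$ on $(0,\infty)$ with identical $\tau$-measure such that $\Phi_{f_1}(\mu)\neq\Phi_{f_2}(\mu)$ for some $\mu\in\mathfrak D(\Phi_{f_1})\cap\mathfrak D(\Phi_{f_2})$.
   Context: All functions are $\mathbb{R}$-valued. The $\tau$-measure of a measurable $f\colon(a,b)\to\mathbb{R}$ is the measure $\tau$ on $\mathbb{R}$ given by $\tau(B)=\int_a^b1_{\{f(s)\in B\}}ds$ for Borel $B\subset\mathbb{R}$. $ID(\mathbb{R}^d)$ ($d$ fixed) is the class of infinitely divisible distributions on $\mathbb{R}^d$. Random measure. For $\mu\in ID(\mathbb{R}^d)$, $X^{(\mu)}=\{X^{(\mu)}(B)\colon B\text{ bounded Borel in }\mathbb{R}\}$ is the (unique in law) $\mathbb{R}^d$-valued homogeneous independently scattered random measure on $\mathbb{R}$ such that $X^{(\mu)}((t,t+1])$ has distribution $\mu$ for all $t$: (1) for disjoint bounded Borel sets $B_1,B_2,\dots$ with bounded union, $\sum_n X^{(\mu)}(B_n)$ converges a.s. and equals $X^{(\mu)}(\bigcup_n B_n)$ a.s.; (2) values on finitely many disjoint sets are independent; (3) $X^{(\mu)}(\{t\})=0$ a.s.; and the law of $X^{(\mu)}(B+t)$ equals that of $X^{(\mu)}(B)$. Integrals on $(a,b)$ (here $(0,\infty)$). Let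 $\mathcal B^0_{(a,b)}$ be the class of Borel sets $B\subset(a,b)$ with $\inf B>a$, $\sup B<b$. For a simple function $f=\sum_{j=1}^n r_j1_{B_j}$ ($B_j$ disjoint Borel in $(a,b)$, $r_j\in\mathbb{R}$), $\int_B f\,dX^{(\mu)}=\sum_j r_jX^{(\mu)}(B\cap B_j)$ for $B\in\mathcal B^0_{(a,b)}$. A measurable $f\colon(a,b)\to\mathbb{R}$ belongs to $\mathbf L_{(a,b)}(X^{(\mu)})$ (locally $X^{(\mu)}$-integrable) if there are simple $f_n\to f$ Lebesgue-a.e. such that $\int_B f_n\,dX^{(\mu)}$ converges in probability for every $B\in\mathcal B^0_{(a,b)}$; the limit is $\int_B f(s)X^{(\mu)}(ds)$, and $\int_p^q$ is the integral over $(p,q]$, $a<p<q<b$. $\mathfrak D(\Phi_f)$ is the class of $\mu\in ID(\mathbb{R}^d)$ with $f\in\mathbf L_{(a,b)}(X^{(\mu)})$ such that $\int_p^q f(s)X^{(\mu)}(ds)$ converges in probability as $p\downarrow a$, $q\uparrow b$; $\Phi_f(\mu)$ is the distribution of the limit. *)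

(* Defs.v *)
From HB Require Import structures.
From mathcomp Require Import all_boot all_order all_algebra.
From mathcomp Require Import all_classical all_reals all_analysis.

Set Implicit Arguments.
Unset Strict Implicit.
Unset Printing Implicit Defensive.
Import Order.TTheory GRing.Theory Num.Theory.
Import numFieldNormedType.Exports.

Local Open Scope classical_set_scope.
Local Open Scope ring_scope.

(* Borel sigma-algebra on matrices, hence on R^d seen as 'rV[R]_d. *)
Section borel_matrix.
Context (R : realType) (m n : nat).

HB.instance Definition _ := @isMeasurable.Build
  (sigma_display (@open 'M[R]_(m, n))) 'M[R]_(m, n)
  (<<s @open 'M[R]_(m, n) >>)
  (@sigma_algebra0 _ setT _) (@sigma_algebraC _ _)
  (@sigma_algebra_bigcup _ setT _).

End borel_matrix.

(* Equality of measures.  It is restricted to measurable sets because a measure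
   is a function on all sets, unconstrained on the nonmeasurable ones. *)
Definition same_measure {R : realType} {disp} {T : measurableType disp}
    (m1 m2 : set T -> \bar R) : Prop :=
  forall A, measurable A -> m1 A = m2 A.

(* The interval (a, b), with possibly infinite end points. *)
Definition oint {R : realType} (a b : \bar R) : set R :=
  [set s | (a < s%:E)%E /\ (s%:E < b)%E].

Definition tau {R : realType} (a b : \bar R) (f : R -> R) (B : set R) : \bar R :=
  (\int[lebesgue_measure]_(s in oint a b) (\1_(f @^-1` B) s)%:E)%E.

Section infinitely_divisible.
Context (R : realType) (d : nat).
Local Notation V := 'rV[R]_d.

Definition convolution (m1 : probability V R) (m2 : set V -> \bar R)
    (A : set V) : \bar R :=
  (\int[m1]_x m2 [set y | A (x + y)%R])%E.

Definition convolution_power (m : probability V R) (n : nat) :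
    set V -> \bar R :=
  iter n (convolution m) (\d_(0 : V)).

Definition ID : set (probability V R) :=
  [set mu | forall n, (0 < n)%N ->
    exists m : probability V R, same_measure mu (convolution_power m n)].

End infinitely_divisible.

Section random_vectors.
Context (R : realType) (d : nat) (disp : measure_display).
Context (Omega : measurableType disp) (P : probability Omega R).
Local Notation V := 'rV[R]_d.

Definition independent_vectors (n : nat) (Y : 'I_n -> {RV P >-> V}) : Prop :=
  forall A : 'I_n -> set V, (forall i, measurable (A i)) ->
    P [set w | forall i, A i (Y i w)] = (\prod_(i < n) P (Y i @^-1` A i))%E.

Definition cvg_in_probability (I : Type) (F : set_system I)
    (Y : I -> Omega -> V) (Z : Omega -> V) : Prop :=
  forall eps : R, 0 < eps ->
    P [set w | eps < `|Y i w - Z w|] @[i --> F] --> 0%E.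

End random_vectors.

Section random_measure.
Context (R : realType) (d : nat) (disp : measure_display).
Context (Omega : measurableType disp) (P : probability Omega R).
Local Notation V := 'rV[R]_d.

(* [random_measure mu X]: X is a version of X^(mu) on (Omega, P).  Only the
   values of X on bounded Borel sets matter. *)
Record random_measure (mu : probability V R) (X : set R -> {RV P >-> V}) :
    Prop := RandomMeasure {
  rm_additive : forall B : nat -> set R,
    (forall n, measurable (B n)) -> trivIset setT B ->
    bounded_set (\bigcup_n B n) ->
    {ae P, forall w, series (fun n => X (B n) w) @ \oo --> X (\bigcup_n B n) w};
  rm_independent : forall (n : nat) (B : 'I_n -> set R),
    (forall i, measurable (B i) /\ bounded_set (B i)) -> trivIset setT B ->
    independent_vectors (fun i => X (B i));
  rm_point : forall t : R, {ae P, forall w, X [set t] w = 0};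
  rm_homogeneous : forall (B : set R) (t : R),
    measurable B -> bounded_set B ->
    same_measure (distribution P (X [set s + t | s in B]))
                 (distribution P (X B));
  rm_unit : forall t : R, same_measure (distribution P (X `]t, t + 1]%classic)) mu }.

End random_measure.

Section integral.
Context (R : realType) (a b : \bar R).

Definition inner_borel : set (set R) :=
  [set B | [/\ measurable B, B `<=` oint a b,
               (a < ereal_inf (EFin @` B))%E & (ereal_sup (EFin @` B) < b)%E]].

Record simple_function := SimpleFunction {
  sf_size : nat;
  sf_coef : 'I_sf_size -> R;
  sf_set : 'I_sf_size -> set R;
  sf_measurable : forall j, measurable (sf_set j);
  sf_sub : forall j, sf_set j `<=` oint a b;
  sf_disjoint : trivIset setT sf_set }.

Definition sf_fun (g : simple_function) (s : R) : R :=
  \sum_(j < sf_size g) sf_coef j * \1_(sf_set j) s.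

(* p decreases to a and q increases to b *)
Definition endpoints : set_system (R * R) :=
  filter_from [set u : R * R | [/\ (a < u.1%:E)%E, u.1 < u.2 & (u.2%:E < b)%E]]
    (fun u => [set v : R * R | [/\ (a < v.1%:E)%E, v.1 <= u.1,
                                   u.2 <= v.2 & (v.2%:E < b)%E]]).

Context (d : nat) (disp : measure_display).
Context (Omega : measurableType disp) (P : probability Omega R).
Local Notation V := 'rV[R]_d.
Implicit Types (X J : set R -> {RV P >-> V}) (f : R -> R).

Definition sf_integral X (g : simple_function) (B : set R) (w : Omega) : V :=
  \sum_(j < sf_size g) sf_coef j *: X (B `&` sf_set j) w.

(* J B is (a version of) the integral of f over B, for all B in inner_borel *)
Definition is_integral X f J : Prop :=
  exists g : nat -> simple_function,
    {ae lebesgue_measure, forall s, oint a b s ->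
       sf_fun (g n) s @[n --> \oo] --> f s} /\
    forall B, inner_borel B ->
      cvg_in_probability P \oo (fun n => sf_integral X (g n) B) (J B).

Definition locally_integrable X f : Prop :=
  measurable_fun (oint a b) f /\ exists J, is_integral X f J.

Definition is_improper_integral X f (Z : {RV P >-> V}) : Prop :=
  exists2 J, is_integral X f J &
    cvg_in_probability P endpoints (fun u => J `]u.1, u.2]%classic) Z.

End integral.

Section Phi.
Context (R : realType) (d : nat) (a b : \bar R) (f : R -> R).
Local Notation V := 'rV[R]_d.

(* Since X^(mu) is unique in law, one may use any version of it, on any
   probability space. *)
Definition DPhi : set (probability V R) :=
  [set mu | ID mu /\
    exists (disp : measure_display) (Omega : measurableType disp)
           (P : probability Omega R) (X : set R -> {RV P >-> V}),
      [/\ random_measure mu X, locally_integrable a b X f &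
          exists Z : {RV P >-> V}, is_improper_integral a b X f Z]].

Definition is_Phi (mu nu : probability V R) : Prop :=
  exists (disp : measure_display) (Omega : measurableType disp)
         (P : probability Omega R) (X : set R -> {RV P >-> V})
         (Z : {RV P >-> V}),
    [/\ random_measure mu X, is_improper_integral a b X f Z &
        same_measure nu (distribution P Z)].

(* Meaningful for mu in DPhi, when is_Phi mu nu determines nu on measurable
   sets; otherwise an arbitrary value. *)
Definition Phi (mu : probability V R) : probability V R :=
  xget mu [set nu | is_Phi mu nu].

End Phi.

(* Main.v *)
Require Import Defs.
From mathcomp Require Import all_boot all_order all_algebra.
From mathcomp Require Import all_classical all_reals all_analysis.
From mathcomp Require Import measurable_realfun ring lra.
Import Order.TTheory GRing.Theory Num.Theory.
Import numFieldNormedType.Exports.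
Local Open Scope classical_set_scope.
Local Open Scope ring_scope.

Set Implicit Arguments.
Unset Strict Implicit.
Unset Printing Implicit Defensive.

(** Both parts already hold for the point mass mu at a nonzero vector c. Its
    random measure is deterministic, X(B) = |B| c, where |B| is the Lebesgue
    measure of B; so, for bounded f, mu lies in the domain of Phi_f exactly
    when the integral of f over (p, q] converges as p -> 0 and q -> oo, and
    Phi_f(mu) is then the point mass at that limit times c. The tau-measure
    does not see the order in which f takes its values, whereas a conditionally
    convergent integral depends on it.

    The functions are slopes of sawtooth functions. Given nodes
    0 <= y_0 <= y_1 <= ... tending to infinity, let f be 1 on the left half of
    each interval (y_n, y_(n+1)] and -1 at all other points ([slope]). The
    primitive of f vanishing at 0 equals -y_0 at every node
    ([primitive_node]), so f takes each of the values 1 and -1 on a set of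
    infinite measure, and all these functions have the same tau-measure, oo at
    1 and at -1 ([tau_slope]). If the gaps between nodes tend to 0, the
    integral of f converges to -y_0. The nodes 2n give a primitive that keeps
    oscillating between 0 and 1, hence an integral that diverges. Part (i)
    compares these two behaviours; part (ii) takes vanishing gaps with y_0 = 0
    and y_0 = 1, so that the integrals are 0 and -1.

    The definitions quantify over all versions of the random measure and over
    all approximating simple functions, so both have to be shown irrelevant.

    - Any random measure X with X((t, t+1]) = c almost surely satisfies
      X(B) = |B| c almost surely ([random_measure_dirac]). The pieces of length
      1/n of a unit interval are independent of the rest of that interval and
      sum with it to a constant, so they are constant by a zero-one law; they
      are equally distributed, hence equal to c/n. Dynkin's induction goes from
      intervals to Borel sets.

    - If simple functions g_n tend to f almost everywhere and the integral of
      g_n over B converges for every Borel subset B of (p, q], then the limit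
      over (p, q] is the integral of f ([setwise_cvg_Rintegral0], applied to
      g_n - f). This is the Vitali-Hahn-Saks theorem in the form needed here,
      proved with a gliding hump.

    - Since the approximating integrals are almost surely constant, convergence
      in probability is convergence of these constants, and the limit is almost
      surely constant ([cvg_in_probability_cst]).

    Everything is read off one coordinate i with c_i = 1. *)

(** * Setwise convergent integrals *)

Section gliding_hump.
Context {disp : measure_display} {T : measurableType disp} {R : realType}.
Context (mu : {measure set T -> \bar R}).

Lemma bounded_integrable (D : set T) (h : T -> R) (M : R) :
  measurable D -> (mu D < +oo)%E -> measurable_fun D h ->
  (forall x, D x -> `|h x| <= M) -> mu.-integrable D (EFin \o h).
Proof.
move=> mD Dfin mh hM; apply: (measurable_bounded_integrable mD Dfin mh).
exists M; split; first exact: num_real.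
by move=> y My x Dx; rewrite /= (le_trans (hM x Dx))// ltW.
Qed.

Lemma Rintegral_le_bound (D : set T) (h : T -> R) (M : R) :
  measurable D -> (mu D < +oo)%E -> measurable_fun D h ->
  (forall x, D x -> `|h x| <= M) ->
  `|\int[mu]_(x in D) h x| <= M * fine (mu D).
Proof.
move=> mD Dfin mh hM.
have ih := bounded_integrable mD Dfin mh hM.
apply: (le_trans (le_normr_Rintegral mD ih)).
rewrite -(Rintegral_cst mu mD); apply: le_Rintegral => //.
- apply: (@bounded_integrable _ _ M) => //; first exact: measurableT_comp.
  by move=> x Dx; rewrite normr_id hM.
- exact: (@bounded_integrable _ _ `|M|).
Qed.

(** Egorov's theorem, with the exceptional set taken inside E so that it can be
    iterated on ever smaller sets. *)
Lemma egorov_subset (E : set T) (h : nat -> T -> R) (eps : R) :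
  measurable E -> (mu E < +oo)%E -> (forall n, measurable_fun E (h n)) ->
  {ae mu, forall x, E x -> h n x @[n --> \oo] --> 0} -> 0 < eps ->
  exists E' : set T, [/\ measurable E', E' `<=` E, fine (mu E') < eps &
    forall e, 0 < e -> \forall n \near \oo,
      forall x, (E `\` E') x -> `|h n x| < e].
Proof.
move=> mE Efin mh h0 eps0.
have [B [mB Beps hB]] := ae_pointwise_almost_uniform mh
  (measurable_cst (0 : R)) mE Efin h0 eps0.
have mEB : measurable (E `&` B) by exact: measurableI.
have lEB : (mu (E `&` B) <= mu B)%E by rewrite le_measure ?inE.
exists (E `&` B); split => //.
  by rewrite -lte_fin fineK ?ge0_fin_numE ?(le_lt_trans lEB)// (lt_trans Beps)// ltry.
move=> e e0; move: (hB [set g : T -> R | forall x, (E `\` B) x -> `|g x| < e]).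
rewrite setDIr setDv set0U; apply.
apply/uniform_nbhs; exists [set uv : R * R | ball uv.1 e uv.2]; split.
  exact: (entourage_ball _ (PosNum e0)).
by move=> g /= gE x /gE; rewrite /ball/= sub0r normrN.
Qed.

Context (D : set T) (mD : measurable D) (Dfin : (mu D < +oo)%E).
Context (h : nat -> T -> R) (mh : forall n, measurable_fun D (h n)).
Context (bh : forall n, exists M, forall x, D x -> `|h n x| <= M).
Context (h0 : {ae mu, forall x, D x -> h n x @[n --> \oo] --> 0}).
Context (cvgh : forall B, measurable B -> B `<=` D ->
  cvgn (fun n => \int[mu]_(x in B) h n x)).

Local Notation nu n B := (\int[mu]_(x in B) h n x).

Let subfin B : measurable B -> B `<=` D -> (mu B < +oo)%E.
Proof. by move=> mB BD; apply: le_lt_trans Dfin; rewrite le_measure ?inE. Qed.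

Let submh n B : measurable B -> B `<=` D -> measurable_fun B (h n).
Proof. by move=> mB BD; exact: measurable_funS (mh n). Qed.

Let nu_le n B M : measurable B -> B `<=` D -> (forall x, B x -> `|h n x| <= M) ->
  `|nu n B| <= M * fine (mu B).
Proof.
by move=> mB BD hM; apply: Rintegral_le_bound => //; [exact: subfin|exact: submh].
Qed.

Let nuD n A B : measurable A -> measurable B -> A `<=` D -> B `<=` A ->
  nu n A = nu n B + nu n (A `\` B).
Proof.
move=> mA mB AD BA.
have mAB : measurable (A `\` B) by exact: measurableD.
rewrite -{1}(setDUK BA) Rintegral_setU ?(setDUK BA)//.
- have [M hM] := bh n.
  apply: (@bounded_integrable _ _ M) => //; [exact: subfin|exact: submh|].
  by move=> x /AD; exact: hM.
- by rewrite disj_set2E setDE setICA setICr setI0.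
Qed.

(** The sets that can still carry a hump: off them h tends to 0 uniformly, so
    discarding their complement does not change the limit of the integrals. *)
Let tail (E : set T) := [/\ measurable E, E `<=` D &
  forall e, 0 < e -> \forall n \near \oo,
    forall x, (D `\` E) x -> `|h n x| < e].

Let limn_tail E : tail E -> limn (fun n => nu n E) = limn (fun n => nu n D).
Proof.
move=> [mE ED uE].
have mDE : measurable (D `\` E) by exact: measurableD.
have nu0 : nu n (D `\` E) @[n --> \oo] --> 0.
  apply/cvgr0Pnorm_le => e e0.
  have c0 : 0 < fine (mu D) + 1 by rewrite ltr_wpDl// fine_ge0.
  near=> n.
  apply: (@le_trans _ _ (e / (fine (mu D) + 1) * fine (mu (D `\` E)))).
    apply: nu_le => //; near: n.
    have := uE _ (divr_gt0 e0 c0).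
    by apply: filterS => n hn x /hn/ltW.
  rewrite mulrAC ler_pdivrMr// ler_pM2l// ler_wpDr//.
  apply: fine_le; rewrite ?ge0_fin_numE ?subfin//.
  by rewrite le_measure ?inE.
have cD := cvgh mD (subset_refl (A := D)).
apply/esym/cvg_lim => //.
have -> : (fun n => nu n D) = (fun n => nu n E + nu n (D `\` E)).
  by apply/funext => n; exact: nuD.
rewrite -[limn _]addr0.
by apply: cvgD nu0; exact: cvgh.
Unshelve. all: by end_near. Qed.

(** One step of the gliding hump. The n-th integral over E is close to the
    limit delta; it is negligible off E because h is uniformly small there, and
    negligible on E' because E' is chosen after n, small with respect to the
    bound on h n. *)
Let hump delta e E N : limn (fun n => nu n D) = delta -> 0 < e -> tail E ->
  exists E' n, [/\ tail E', E' `<=` E, (N < n)%N, `|nu n E - delta| <= e &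
    forall B, measurable B -> B `<=` D -> B `<=` ~` E \/ B `<=` E' ->
      `|nu n B| <= e].
Proof.
move=> limD e0 tE; have [mE ED uE] := tE.
have c0 : 0 < fine (mu D) + 1 by rewrite ltr_wpDl// fine_ge0.
have : nu n E @[n --> \oo] --> delta.
  by rewrite -limD -(limn_tail tE); exact: cvgh.
move=> /cvgrPdist_le/(_ e e0) nuE.
have [n [Nn nE nsmall]] : exists n, [/\ (N < n)%N, `|nu n E - delta| <= e &
    forall x, (D `\` E) x -> `|h n x| < e / (fine (mu D) + 1)].
  near \oo => n; exists n; split; near: n.
  - exact: nbhs_infty_gt.
  - by apply: filterS nuE => n; rewrite distrC.
  - exact: uE (divr_gt0 e0 c0).
have [M0 hM0] := bh n.
pose M := `|M0| + 1.
have M1 : 0 < M by rewrite ltr_wpDl.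
have hM x : D x -> `|h n x| <= M.
  by move=> /hM0/le_trans; apply; rewrite ler_wpDr// ler_norm.
have h0E : {ae mu, forall x, E x -> h n x @[n --> \oo] --> 0}.
  by apply: filterS h0 => x + /ED; apply.
have [E' [mE' E'E E'e uE']] := egorov_subset mE (subfin mE ED)
  (fun n => submh n mE ED) h0E (divr_gt0 e0 M1).
exists E', n; split => //.
  split => //; first exact: subset_trans ED.
  move=> r r0; near=> k => x [Dx nE'x]; have [Ex|nEx] := pselect (E x).
  - have : (E `\` E') x by [].
    by move: x {Dx nE'x Ex}; near: k; exact: uE'.
  - have : (D `\` E) x by [].
    by move: x {Dx nE'x nEx}; near: k; exact: uE.
move=> B mB BD [BE|BE].
- apply: (@le_trans _ _ (e / (fine (mu D) + 1) * fine (mu B))).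
    by apply: nu_le => // x Bx; apply/ltW/nsmall; split; [exact: BD|exact: BE].
  rewrite mulrAC ler_pdivrMr// ler_pM2l// ler_wpDr//.
  by apply: fine_le; rewrite ?ge0_fin_numE ?subfin// le_measure ?inE.
- apply: (@le_trans _ _ (M * fine (mu B))).
    by apply: nu_le => // x Bx; apply/hM/BD.
  rewrite mulrC -ler_pdivlMr//; apply: le_trans (ltW E'e).
  have E'D : E' `<=` D by exact: subset_trans ED.
  by apply: fine_le; rewrite ?ge0_fin_numE ?subfin// le_measure ?inE.
Unshelve. all: by end_near. Qed.

(** If the limit delta over D were not 0, iterating [hump] would give disjoint
    sets E_j minus E_(j+1), each carrying almost all of delta for the index n_j
    and almost nothing for the other indices. On the union B of those with j
    even, the integrals of h (n j) are then close to delta for j even and to 0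
    for j odd, so that they cannot converge. *)
Lemma setwise_cvg_Rintegral0 : \int[mu]_(x in D) h n x @[n --> \oo] --> 0.
Proof.
have cD := cvgh mD (subset_refl (A := D)).
suff l0 : limn (fun n => nu n D) = 0 by move: cD; rewrite /= l0.
apply/eqP/negP => /negP; set delta := limn _ => delta0.
(* Four errors of size e for even j, two for odd j, and two in comparing them
   with the limit over B: together |delta|. *)
pose e := `|delta| / 8%:R.
have e0 : 0 < e by rewrite divr_gt0// normr_gt0.
have tD : tail D by split => // r r0; near=> n => x; rewrite setDv.
pose St := ({E | tail E} * nat)%type.
pose step (p q : St) := let E := sval p.1 in let E' := sval q.1 in let n := q.2 in
  [/\ E' `<=` E, (p.2 < n)%N, `|nu n E - delta| <= e &
    forall B, measurable B -> B `<=` D -> B `<=` ~` E \/ B `<=` E' ->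
      `|nu n B| <= e].
have /(@dependent_choice St)/(_ (exist _ D tD, 0%N)) : forall p, {q | step p q}.
  move=> [[E tE] N]; apply/cid.
  have [E' [n [tE' ? ? ? ?]]] := hump N (erefl delta) e0 tE.
  by exists (exist _ E' tE', n).
move=> [p [p0 stepp]].
pose E j := sval (p j).1; pose n j := (p j.+1).2.
have [mE ED] : (forall j, measurable (E j)) /\ (forall j, E j `<=` D).
  by split=> j; have [] := svalP (p j).1.
have E'E j : E j.+1 `<=` E j by case: (stepp j).
have Edecr : {homo E : i j / (i <= j)%N >-> j `<=` i}.
  move=> i j /subnK <-; elim: (j - i)%N => // k IH.
  by rewrite addSn; exact: subset_trans (E'E _) IH.
have nincr j : (j <= n j)%N.
  elim: j => // j IH; apply: leq_ltn_trans IH _.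
  by have [] := stepp j.+1.
have ncvg : n j @[j --> \oo] --> \oo.
  apply/cvgnyPge => A; near=> j; apply: leq_trans (nincr j).
  by near: j; exact: nbhs_infty_ge.
pose B := \bigcup_(j in [set j | ~~ odd j]) (E j `\` E j.+1).
have mB : measurable B by apply: bigcup_measurable => j _; exact: measurableD.
have BD : B `<=` D by move=> x [j _ [/ED]].
have BE j : ~~ odd j -> B `&` E j `\` E j.+1 = E j `\` E j.+1.
  move=> oj; apply/seteqP; split => [x [[]]//|x [Ex nEx]]; split => //.
  by split => //; exists j.
have BE0 j : odd j -> B `&` E j `\` E j.+1 = set0.
  move=> oj; rewrite -subset0 => x [[[i /= oi [Eix nEix]] Ejx] nEjx].
  have [ij|ji|ij] := ltngtP i j.
  - by apply: nEix; exact: (Edecr i.+1 j).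
  - by apply: nEjx; exact: (Edecr j.+1 i).
  - by move: oi; rewrite ij oj.
have nuB j : `|nu (n j) B - nu (n j) (B `&` E j `\` E j.+1)| <= e + e.
  have [_ _ _ small] := stepp j.
  have mBE : measurable (B `&` E j) by exact: measurableI.
  have mBE' : measurable (B `&` E j `&` E j.+1) by exact: measurableI.
  rewrite (nuD (n j) mB mBE BD); last by move=> x [].
  have BED : B `&` E j `<=` D by move=> x [/BD].
  rewrite (nuD (n j) mBE mBE' BED); last by move=> x [].
  have -> : (B `&` E j) `\` (B `&` E j `&` E j.+1) = B `&` E j `\` E j.+1.
    by rewrite setDIr setDv set0U.
  rewrite addrAC addrK; apply: (le_trans (ler_normD _ _)); apply: lerD.
    apply: small => //; first by move=> x [] [] /BD.
    by right => x [].
  apply: small; [exact: measurableD|by move=> x [] /BD|left].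
  by move=> x [Bx nBE] Ex; apply: nBE.
have humpE j : `|nu (n j) (E j `\` E j.+1) - delta| <= e + e.
  have [_ _ nE small] := stepp j.
  have -> : nu (n j) (E j `\` E j.+1) = nu (n j) (E j) - nu (n j) (E j.+1).
    by rewrite (nuD (n j) (mE j) (mE j.+1)) ?addrK 1?addrC ?addKr.
  rewrite addrAC; apply: (le_trans (ler_normB _ _)); apply: lerD => //.
  by apply: small => //; right.
have even j : ~~ odd j -> `|nu (n j) B - delta| <= e + e + (e + e).
  move=> /BE oj; have := nuB j; rewrite oj => Bj.
  have := ler_normD (nu (n j) B - nu (n j) (E j `\` E j.+1))
            (nu (n j) (E j `\` E j.+1) - delta).
  rewrite addrA subrK => /le_trans; apply; exact: lerD.
have oddn j : odd j -> `|nu (n j) B| <= e + e.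
  by move=> /BE0 oj; have := nuB j; rewrite oj Rintegral_set0 subr0.
have cB := cvgh mB BD.
have /cvgrPdist_lt/(_ e e0) Bn : nu (n j) B @[j --> \oo] --> limn (fun n => nu n B).
  by apply: (cvg_comp (G := \oo) n (fun n => nu n B)).
have [k kB] : exists k, forall j, (k <= j)%N ->
    `|limn (fun n => nu n B) - nu (n j) B| < e.
  by case: Bn => k _ kB; exists k.
have := kB k.*2; have := kB k.*2.+1.
rewrite -addnn leq_addr => /(_ (leqW (leq_addr _ _))) + /(_ isT).
have := even k.*2; have := oddn k.*2.+1; rewrite /= odd_double addnn.
move=> /(_ isT) + /(_ isT).
have : `|delta| = e * 8%:R by rewrite /e divfK// pnatr_eq0.
move: (limn _) => l; move: (nu _ _) (nu _ _) => b a de ha hb hla hlb.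
have := ler_normD (delta - b) b.
have := ler_normD (b - l) l.
have := ler_normD (l - a) a.
rewrite !subrK (distrC delta b) (distrC b l); lra.
Unshelve. all: by end_near. Qed.

End gliding_hump.

(** * Coordinates of random vectors *)

Section coordinates.
Context {R : realType} {d : nat}.

Lemma measurable_coord (i : 'I_d) :
  measurable_fun [set: 'rV[R]_d] (fun v : 'rV[R]_d => v 0 i).
Proof.
apply: (measurability _ (RGenOInfty.measurableE R)) => // _ [_ [x ->] <-].
rewrite setTI; apply: sub_sigma_algebra.
apply: open_comp; last exact: rray_open.
by move=> v _; exact: coord_continuous.
Qed.

Lemma mx_norm_coord (v : 'rV[R]_d) i : `|v 0 i| <= `|v|.
Proof.
rewrite [leRHS]/Num.norm/= mx_normrE.
by apply/bigmax_geP; right; exists (0, i).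
Qed.

Lemma mx_norm_gtP (v : 'rV[R]_d) (e : R) : 0 < e ->
  (e < `|v|) = [exists i, e < `|v 0 i|].
Proof.
move=> e0; apply/idP/existsP => [|[i vi]]; last first.
  exact: lt_le_trans vi (mx_norm_coord v i).
apply: contraPP => /forallNP vi; apply/negP; rewrite -leNgt.
rewrite [leLHS]/Num.norm/= mx_normrE; apply/bigmax_leP; split=> [|[a i] _ /=].
  exact: ltW.
by rewrite (ord1 a) leNgt; apply/negP/vi.
Qed.

End coordinates.

(** * Almost sure equalities *)

Section almost_sure.
Context {R : realType} {disp : measure_display} {Omega : measurableType disp}.
Context (P : probability Omega R).

Lemma ae_false : {ae P, forall w, False} -> False.
Proof.
move=> H; have PF : ProperFilter (almost_everywhere P).
  apply: ae_properfilter_algebraOfSetsType.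
  by rewrite [ltRHS](@probability_setT _ _ _ P) lte01.
by have [w] := @filter_ex _ _ PF _ H.
Qed.

Lemma ae_eq_cst (a b : R) (Y : Omega -> R) :
  {ae P, forall w, Y w = a} -> {ae P, forall w, Y w = b} -> a = b.
Proof.
move=> Ya Yb; apply/eqP/negP => /negP ab; apply: ae_false.
by apply: filterS2 Ya Yb => w -> ba; rewrite ba eqxx in ab.
Qed.

Lemma prob1_ae (A : set Omega) : measurable A -> P A = 1%E ->
  {ae P, forall w, A w}.
Proof.
move=> mA A1; apply/negligibleP; first exact: measurableC.
by rewrite [LHS](@probability_setC _ _ _ P)// A1 subee.
Qed.

Lemma ae_prob1 (A : set Omega) : measurable A -> {ae P, forall w, A w} ->
  P A = 1%E.
Proof.
move=> mA /(negligibleP _ (measurableC mA)) A0.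
rewrite -[X in P X](setCK A) probability_setC; last exact: measurableC.
by rewrite [X in (1 - X)%E]A0 sube0.
Qed.

Lemma zero_one_ae (A : set Omega) : measurable A -> P A = (P A * P A)%E ->
  {ae P, forall w, A w} \/ {ae P, forall w, ~ A w}.
Proof.
move=> mA; have fA : P A \is a fin_num by exact: fin_num_measure.
rewrite -(fineK fA) -EFinM => -[] /eqP; rewrite -subr_eq0 -{1}[fine _]mulr1.
rewrite -mulrBr mulf_eq0 => /orP[/eqP A0|].
  right; apply: (prob1_ae (measurableC mA)).
  by rewrite probability_setC// -(fineK fA) A0 sube0.
by rewrite subr_eq0 => /eqP A1; left; apply: prob1_ae => //; rewrite -(fineK fA) -A1.
Qed.

(** The constant is the infimum of the t such that Y <= t almost surely. *)
Lemma ae_cst_of_decided (Y : Omega -> R) :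
  (forall t, {ae P, forall w, Y w <= t} \/ {ae P, forall w, ~ Y w <= t}) ->
  exists m, {ae P, forall w, Y w = m}.
Proof.
move=> Yt; pose S := [set t | {ae P, forall w, Y w <= t}].
have S0 : S !=set0.
  apply/set0P/negP => /eqP S0; apply: ae_false.
  have : {ae P, forall w, forall n, ~ Y w <= n%:R}.
    apply/ae_foralln => n; case: (Yt n%:R) => // Sn.
    by have : S n%:R by []; rewrite S0.
  apply: filterS => w /(_ (Num.truncn `|Y w|).+1); apply.
  by rewrite (le_trans (ler_norm _))// ltW// truncnS_gt.
have lbS : has_lbound S.
  apply: contrapT => nlb; apply: ae_false.
  have : {ae P, forall w, forall n, Y w <= - n%:R}.
    apply/ae_foralln => n.
    have [t [St tn]] : exists t, S t /\ t < - n%:R.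
      apply: contrapT => nt; apply: nlb; exists (- n%:R) => t St.
      by rewrite leNgt; apply/negP => tn; apply: nt; exists t.
    by apply: filterS St => w /le_trans; apply; exact: ltW.
  apply: filterS => w /(_ (Num.truncn `|Y w|).+1).
  rewrite lerNr leNgt => /negP; apply.
  by rewrite (le_lt_trans (ler_norm _))// normrN truncnS_gt.
exists (inf S).
have up : {ae P, forall w, forall n, Y w <= inf S + n.+1%:R^-1}.
  apply/ae_foralln => n.
  have n0 : 0 < (n.+1%:R^-1 : R) by rewrite invr_gt0 ltr0Sn.
  have [t St tn] := inf_adherent n0 (conj S0 lbS).
  by apply: filterS St => w /le_trans; apply; exact: ltW.
have lo : {ae P, forall w, forall n, inf S - n.+1%:R^-1 < Y w}.
  apply/ae_foralln => n; case: (Yt (inf S - n.+1%:R^-1)) => [St|].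
    have := ge_inf lbS St; rewrite lerBrDr -subr_ge0 opprD addrA subrr sub0r.
    by rewrite oppr_ge0 leNgt invr_gt0 ltr0Sn.
  by apply: filterS => w /negP; rewrite -ltNge.
apply: filterS2 up lo => w upw low; apply/eqP; rewrite eq_le.
apply/andP; split; apply/ler_addgt0Pr => e e0.
- have [N _ /(_ N (leqnn N))/= Ne] := near_infty_natSinv_lt (PosNum e0).
  by apply: (le_trans (upw N)); rewrite lerD2l ltW.
- have [N _ /(_ N (leqnn N))/= Ne] := near_infty_natSinv_lt (PosNum e0).
  by rewrite -lerBlDr; apply: (le_trans _ (ltW (low N))); rewrite lerB// ltW.
Qed.

Lemma le_prob_ae (E F : set Omega) : measurable E -> measurable F ->
  {ae P, forall w, E w -> F w} -> (P E <= P F)%E.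
Proof.
move=> mE mF EF; have mEF : measurable (E `\` F) by exact: measurableD.
have EF0 : P (E `\` F) = 0%E.
  apply/negligibleP => //; apply: negligibleS EF => w [Ew nFw] /= EFw.
  exact/nFw/EFw.
apply: (@le_trans _ _ (P (F `|` (E `\` F)))).
  by apply: le_measure; rewrite ?inE//; [exact: measurableU|
    move=> w Ew; have [Fw|nFw] := pselect (F w); [left|right]].
by rewrite measureU0.
Qed.

(** Almost surely Y = c - Z, so Y is independent of itself: every event Y <= t
    has a probability equal to its own square. *)
Lemma ae_cst_of_indep_sum_cst (Y Z : Omega -> R) (c : R) :
  measurable_fun setT Y -> measurable_fun setT Z ->
  (forall A B, measurable A -> measurable B ->
    P (Y @^-1` A `&` Z @^-1` B) = (P (Y @^-1` A) * P (Z @^-1` B))%E) ->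
  {ae P, forall w, Y w + Z w = c} ->
  exists m, {ae P, forall w, Y w = m}.
Proof.
move=> mY mZ YZ YZc; apply: ae_cst_of_decided => t.
pose A := `]-oo, t]%classic : set R; pose B := `[c - t, +oo[%classic : set R.
have mYA : measurable (Y @^-1` A).
  rewrite -[X in measurable X]setTI; apply: mY => //; exact: measurable_itv.
have mZB : measurable (Z @^-1` B).
  rewrite -[X in measurable X]setTI; apply: mZ => //; exact: measurable_itv.
have YB : {ae P, forall w, (Y @^-1` A) w -> (Z @^-1` B) w}.
  by apply: filterS YZc => w; rewrite /A/B/= !in_itv/= andbT => ? ?; lra.
have BY : {ae P, forall w, (Z @^-1` B) w -> (Y @^-1` A) w}.
  by apply: filterS YZc => w; rewrite /A/B/= !in_itv/= andbT => ? ?; lra.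
have PBA : P (Z @^-1` B) = P (Y @^-1` A).
  by apply/eqP; rewrite eq_le !le_prob_ae.
suff : {ae P, forall w, (Y @^-1` A) w} \/ {ae P, forall w, ~ (Y @^-1` A) w}.
  by case=> H; [left|right]; apply: filterS H => w; rewrite /A/= in_itv.
apply: zero_one_ae => //.
rewrite -[X in _ = (_ * X)%E]PBA -YZ; try exact: measurable_itv.
apply/eqP; rewrite eq_le !le_prob_ae//; try exact: measurableI.
- by apply: aeW => w [].
- by apply: filterS YB => w YBw Yw; split=> //; exact: YBw.
Qed.

End almost_sure.

(** * Lengths of bounded Borel sets *)

Section lebesgue_facts.
Context {R : realType}.
Local Notation leb := (@lebesgue_measure R).

Definition len (B : set R) : R := fine (leb B).

Lemma bounded_fin_num (B : set R) : measurable B -> bounded_set B ->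
  leb B \is a fin_num.
Proof.
move=> mB [M [_ /(_ (`|M| + 1))]].
rewrite (le_lt_trans (ler_norm _)) ?ltrDl// => /(_ isT) BM.
rewrite ge0_fin_numE//.
apply: (@le_lt_trans _ _ (leb `[- (`|M| + 1), `|M| + 1]%classic)).
  apply: le_measure; rewrite ?inE// => x /BM /=.
  by rewrite ler_norml in_itv.
by rewrite lebesgue_measure_itv/=; case: ifP => _; rewrite ?ltry// -EFinB ltry.
Qed.

Lemma bounded_set_sub (A B : set R) : A `<=` B -> bounded_set B -> bounded_set A.
Proof.
by move=> AB [M [Mr BM]]; exists M; split => // x /BM Bx y /AB/Bx.
Qed.

Lemma bounded_set_itv (a b : R) : bounded_set `]a, b]%classic.
Proof.
exists (`|a| + `|b|); split; first exact: num_real.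
move=> M abM x /=; rewrite in_itv/= => /andP[ax xb]; rewrite ler_norml.
have := ler_norm b; have := lerNnormlW (lexx `|a|).
by have := normr_ge0 a; have := normr_ge0 b; move: abM ax xb; lra.
Qed.

Lemma itvocU (a b c : R) : a <= b -> b <= c ->
  `]a, b] `|` `]b, c] = `]a, c]%classic.
Proof.
by move=> ab bc; rewrite -itv_bndbnd_setU// bnd_simp.
Qed.

Lemma itvocI (a b c : R) : `]a, b] `&` `]b, c] = set0.
Proof.
by rewrite -subset0 => x []; rewrite /= !in_itv/= => /andP[_ ?] /andP[]; lra.
Qed.

Lemma len0 : len set0 = 0.
Proof. by rewrite /len measure0. Qed.

Lemma len_itv (a b : R) : a <= b -> len `]a, b] = b - a.
Proof.
rewrite /len lebesgue_measure_itv/= lte_fin le_eqVlt => /orP[/eqP ->|ab].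
  by rewrite ltxx subrr.
by rewrite ab.
Qed.

Lemma lenU (A B : set R) : measurable A -> measurable B -> A `&` B = set0 ->
  leb A \is a fin_num -> leb B \is a fin_num ->
  len (A `|` B) = len A + len B.
Proof. by move=> mA mB AB fA fB; rewrite /len measureU// fineD. Qed.

Lemma len_series (F : nat -> set R) : (forall n, measurable (F n)) ->
  trivIset setT F -> leb (\bigcup_n F n) \is a fin_num ->
  series (len \o F) @ \oo --> len (\bigcup_n F n).
Proof.
move=> mF tF fin.
have Ffin n : leb (F n) \is a fin_num.
  rewrite ge0_fin_numE//; apply: (@le_lt_trans _ _ (leb (\bigcup_n F n))).
    apply: le_measure; rewrite ?inE; [exact: mF| |].
      exact: (bigcup_measurable (fun n _ => mF n)).
    exact: bigcup_sup.
  by rewrite -ge0_fin_numE.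
have : (fun n => \sum_(0 <= k < n) leb (F k))%E @ \oo --> leb (\bigcup_n F n).
  exact: (@measure_sigma_additive _ _ _ leb _ mF tF).
rewrite -(fineK fin) => /fine_cvg; apply: cvg_trans; apply: near_eq_cvg.
near=> n; rewrite /= (eq_bigr (fun k => (len (F k))%:E)) => [|k _].
  by rewrite sumEFin.
by rewrite fineK.
Unshelve. all: by end_near. Qed.

End lebesgue_facts.

(** * Random measures with deterministic unit increments *)

Section deterministic.
Context {R : realType} {d : nat} {disp : measure_display}.
Context {Omega : measurableType disp} {P : probability Omega R}.
Local Notation V := 'rV[R]_d.
Context (c : V) (X : set R -> {RV P >-> V}).
Context (Xc : random_measure (\d_c : probability V R) X) (i : 'I_d).

Local Notation Y B := (fun w => X B w 0 i).

Let mX B : measurable_fun setT (Y B).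
Proof. by apply: (measurableT_comp (measurable_coord i)). Qed.

Let X_series (B : nat -> set R) : (forall n, measurable (B n)) ->
  trivIset setT B -> bounded_set (\bigcup_n B n) ->
  {ae P, forall w, series (fun n => X (B n) w 0 i) @ \oo -->
     X (\bigcup_n B n) w 0 i}.
Proof.
move=> mB tB bB; have := rm_additive Xc mB tB bB.
apply: filterS => w Bw.
have -> : series (fun n => X (B n) w 0 i) =
    (fun v : V => v 0 i) \o series (fun n => X (B n) w).
  by apply/funext => n; rewrite /series/= summxE.
by apply: cvg_comp Bw _; exact: coord_continuous.
Qed.

Let X0 : {ae P, forall w, X set0 w 0 i = 0}.
Proof.
have := @X_series (fun=> set0) (fun=> measurable0) (@trivIset_set0 _ _ _).
rewrite bigcup0// => /(_ (bounded_set_sub (@sub0set _ _) (bounded_set_itv 0 0))).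
apply: filterS => w Hw; set x := X set0 w 0 i.
(* All terms of the convergent series are x, so x is the limit of the terms. *)
have : series (fun _ : nat => x) n.+1 - series (fun _ : nat => x) n
    @[n --> \oo] --> x - x.
  by apply: cvgB => //; rewrite cvg_shiftS.
rewrite subrr; under eq_fun do rewrite seriesSB.
by move/(cvg_lim (@Rhausdorff R)); rewrite lim_cst.
Qed.

Let XU (A B : set R) : measurable A -> measurable B -> A `&` B = set0 ->
  bounded_set (A `|` B) ->
  {ae P, forall w, X (A `|` B) w 0 i = X A w 0 i + X B w 0 i}.
Proof.
move=> mA mB AB bAB.
have mF n : measurable (bigcup2 A B n).
  rewrite /bigcup2; case: ifP => // _; case: ifP => // _; exact: measurable0.
have tF : trivIset setT (bigcup2 A B) by rewrite -trivIset_bigcup2.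
have := X_series mF tF; rewrite bigcup2E => /(_ bAB).
apply: filterS2 X0 => w w0 Hw.
apply: (cvg_unique _ Hw); first exact: Rhausdorff.
apply: cvg_near_cst; exists 2%N => // -[|[|n]]//= _.
rewrite /series/= !big_nat_recl// big1 ?addr0 => [//|k _].
by rewrite /bigcup2/= w0.
Qed.

Let X_indep (A B : set R) : measurable A -> measurable B -> A `&` B = set0 ->
  bounded_set A -> bounded_set B -> forall S T : set R,
  measurable S -> measurable T ->
  P ((Y A) @^-1` S `&` (Y B) @^-1` T) =
  (P ((Y A) @^-1` S) * P ((Y B) @^-1` T))%E.
Proof.
move=> mA mB AB bA bB S T mS mT.
pose B2 (k : 'I_2) := if k == 0 then A else B.
have tB2 : trivIset setT B2.
  apply/trivIsetP => -[[|[|//]] k1] [[|[|//]] k2] _ _ //= _; rewrite /B2/=//.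
  by rewrite setIC.
pose S2 (k : 'I_2) := [set v : V | (if k == 0 then S else T) (v 0 i)].
have mS2 k : measurable (S2 k).
  have : measurable (if k == 0 then S else T) by case: ifP.
  by move=> /(measurable_coord i measurableT); rewrite setTI.
have mB2 k : measurable (B2 k) /\ bounded_set (B2 k) by rewrite /B2; case: ifP.
have := rm_independent Xc mB2 tB2 mS2.
rewrite !big_ord_recl big_ord0 mule1 => <-; congr (P _).
apply/seteqP; split => w /=.
  by move=> [Aw Bw] [[|[|//]] k].
by move=> Hw; split; [exact: (Hw ord0)|exact: (Hw (lift ord0 ord0))].
Qed.

Let X_homogeneous (B : set R) (t : R) (S : set R) :
  measurable B -> bounded_set B -> measurable S ->
  P ((Y [set s + t | s in B]) @^-1` S) =
  P ((Y B) @^-1` S).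
Proof.
move=> mB bB mS; have mS' : measurable [set v : V | S (v 0 i)].
  by have := measurable_coord i measurableT mS; rewrite setTI.
exact: (rm_homogeneous Xc t mB bB mS').
Qed.

Let X_unit t : {ae P, forall w, X `]t, t + 1]%classic w 0 i = c 0 i}.
Proof.
apply: prob1_ae.
  have := mX `]t, t + 1]%classic measurableT (measurable_set1 (c 0 i)).
  by rewrite setTI.
have mS' : measurable [set v : V | v 0 i = c 0 i].
  by have := measurable_coord i measurableT (measurable_set1 (c 0 i)); rewrite setTI.
transitivity (\d_c [set v : V | v 0 i = c 0 i] : \bar R).
  exact: (rm_unit Xc t mS').
by rewrite diracE mem_set.
Qed.

Let piece n : 0 < (n.+1%:R : R)^-1. Proof. by rewrite invr_gt0 ltr0Sn. Qed.

(** The piece (0, h] with h = 1/(n+1) and its independent complement (h, 1] have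
    the constant sum c_i, so the piece is a constant m; by homogeneity so is
    every translate of it, and (n+1) m = c_i. *)
Let X_grid n j t : {ae P, forall w,
  X `]t, t + j%:R / n.+1%:R]%classic w 0 i = j%:R / n.+1%:R * c 0 i}.
Proof.
have pn := piece n; set h := (n.+1%:R : R)^-1 in pn *.
have h1 : h <= 1 by rewrite invf_le1 ?ler1n ?ltr0Sn.
have [m Xm] : exists m, {ae P, forall w, X `]0, h]%classic w 0 i = m}.
  have hU : `]0, h] `|` `]h, 1] = `]0, 1]%classic :> set R.
    by rewrite itvocU// ltW.
  have hI : `]0, h] `&` `]h, 1] = set0 :> set R.
    exact: itvocI.
  apply: (@ae_cst_of_indep_sum_cst _ _ _ P _ (Y `]h, 1]%classic) (c 0 i)) => //.
    by move=> S T mS mT; apply: X_indep => //; exact: bounded_set_itv.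
  have := XU (measurable_itv `]0, h]) (measurable_itv `]h, 1]) hI.
  rewrite hU => /(_ (bounded_set_itv _ _)) XUh.
  by have := X_unit 0; rewrite add0r; apply: filterS2 XUh => w ->.
have Xtm s : {ae P, forall w, X `]s, s + h]%classic w 0 i = m}.
  apply: prob1_ae.
    have := mX `]s, s + h]%classic measurableT (measurable_set1 m).
    by rewrite setTI.
  have -> : `]s, s + h]%classic = [set r + s | r in `]0, h]%classic].
    apply/seteqP; split=> [x|_ [x + <-]]; rewrite /= !in_itv/= => xs.
      by exists (x - s); rewrite ?subrK// in_itv/=; lra.
    by lra.
  rewrite (X_homogeneous s _ _ (measurable_set1 m))//; last exact: bounded_set_itv.
  apply: ae_prob1 => //.
  by have := mX `]0, h]%classic measurableT (measurable_set1 m); rewrite setTI.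
have Xj s k : {ae P, forall w, X `]s, s + k%:R * h]%classic w 0 i = k%:R * m}.
  elim: k => [|k IH].
    by rewrite !mul0r addr0 set_itvoc0.
  have kU : `]s, s + k%:R * h] `|` `]s + k%:R * h, s + k%:R * h + h] =
      `]s, s + k.+1%:R * h]%classic.
    have k0 : 0 <= k%:R * h by rewrite mulr_ge0// ltW.
    rewrite itvocU; [|lra..].
    by rewrite -addrA -[k.+1]addn1 natrD mulrDl mul1r.
  have kI : `]s, s + k%:R * h] `&` `]s + k%:R * h, s + k%:R * h + h] = set0 :> set R.
    exact: itvocI.
  have := XU (measurable_itv `]s, s + k%:R * h])
             (measurable_itv `]s + k%:R * h, s + k%:R * h + h]) kI.
  rewrite kU => /(_ (bounded_set_itv _ _)); apply: filterS3 IH (Xtm (s + k%:R * h)).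
  by move=> w -> -> ->; rewrite -[k.+1]addn1 natrD mulrDl mul1r.
have nh : n.+1%:R * h = 1 by rewrite divff// pnatr_eq0.
have mc : n.+1%:R * m = c 0 i.
  by apply: ae_eq_cst (Xj 0 n.+1) _; rewrite nh; exact: X_unit.
have -> : j%:R / n.+1%:R * c 0 i = j%:R * m.
  by rewrite -mc -!mulrA (mulrA h) (mulrC h) nh mul1r.
exact: Xj.
Qed.

(** A nonnegative rational length is a multiple of some 1/(n+1), to which
    [X_grid] applies. *)
Let X_rat (q : rat) (N : nat) : (ratr q : R) <= N%:R ->
  {ae P, forall w, X `]ratr q, N%:R]%classic w 0 i = (N%:R - ratr q) * c 0 i}.
Proof.
move=> qN; have [j [n jn]] : exists j n, N%:R - ratr q = j%:R / n.+1%:R :> R.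
  pose r : rat := N%:R - q.
  have rE : N%:R - ratr q = ratr r :> R by rewrite rmorphB/= ratr_nat.
  have r0 : 0 <= r by rewrite -(ler_rat R) rmorph0 -rE subr_ge0.
  exists `|numq r|%N, `|denq r|%N.-1.
  rewrite rE prednK ?absz_gt0 ?denq_eq0// /ratr.
  by rewrite !natr_absz (gtr0_norm (denq_gt0 _)) ger0_norm ?numq_ge0.
have -> : N%:R = ratr q + j%:R / n.+1%:R :> R by rewrite -jn subrKC.
by rewrite [ratr q + _]addrC addrK addrC; exact: X_grid.
Qed.

(** X is only constrained on bounded sets, so Dynkin's induction, which runs
    through complements, takes place inside a bounded window. *)
Let window (N : nat) : set R := `]- N%:R, N%:R]%classic.

Let X_window N : {ae P, forall w, X (window N) w 0 i = len (window N) * c 0 i}.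
Proof.
have N0 : 0 <= N%:R :> R by [].
rewrite /window len_itv; last by lra.
by have := @X_rat (- N%:R) N; rewrite rmorphN/= ratr_nat; apply; lra.
Qed.

(** Rays with a rational end point are stable under intersection and generate
    the Borel sets. *)
Let X_borel_window N (B : set R) : measurable B -> {ae P, forall w,
  X (B `&` window N) w 0 i = len (B `&` window N) * c 0 i}.
Proof.
have bw (A : set R) : bounded_set (A `&` window N).
  exact: bounded_set_sub (@subIsetr _ _ _) (bounded_set_itv _ _).
have mw : measurable (window N) by exact: measurable_itv.
have fw (A : set R) : measurable A -> lebesgue_measure (A `&` window N) \is a fin_num.
  by move=> mA; apply: bounded_fin_num => //; exact: measurableI.
pose G := [set A : set R | exists q : rat, A = `]ratr q, +oo[%classic].
have GE : @measurable _ R = <<s G >>.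
  transitivity ((@RGenOInfty.G R).-sigma.-measurable).
    exact: RGenOInfty.measurableE.
  apply/seteqP; split.
    apply: smallest_sub; first exact: smallest_sigma_algebra.
    move=> _ [x ->].
    have -> : `]x, +oo[%classic =
        \bigcup_(q : rat) (if x < ratr q then `]ratr q, +oo[%classic else set0).
      apply/seteqP; split=> [y|y [q _]]; rewrite /= in_itv/= andbT.
        move=> /rat_in_itvoo[q]; rewrite in_itv/= => /andP[xq qy].
        by exists q => //; rewrite xq /= in_itv/= andbT.
      by case: ifPn => // xq; rewrite /= in_itv/= andbT; exact: lt_trans.
    apply: (@countable_bigcupT_measurable _ (g_sigma_algebraType G)) => // q.
    case: ifPn => _; last exact: measurable0.
    by apply: sub_sigma_algebra; exists q.
  apply: smallest_sub; first exact: smallest_sigma_algebra.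
  by move=> _ [q ->]; apply: sub_sigma_algebra; exists (ratr q).
move=> mB; have : <<s G >> B by rewrite -GE.
move: B mB => B _; apply: (dynkin_induction (G := G) (P := fun A => {ae P, forall w,
  X (A `&` window N) w 0 i = len (A `&` window N) * c 0 i})) => //.
- move=> _ _ [q ->] [r ->]; wlog : q r / q <= r => [H|qr].
    have [|/ltW] := leP q r; first exact: H.
    by rewrite setIC; exact: H.
  exists r; apply/seteqP; split=> x; rewrite /= !in_itv/= !andbT; first by case.
  by move=> rx; split => //; apply: le_lt_trans rx; rewrite ler_rat.
- by rewrite setTI; exact: X_window.
- move=> _ [q ->].
  have [Nq|qN] := leP (N%:R) (ratr q : R).
    have -> : `]ratr q, +oo[%classic `&` window N = set0.
      by rewrite -subset0 => x []; rewrite /window/= !in_itv/= andbT; lra.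
    by rewrite len0 mul0r; exact: X0.
  have [qNN|NqN] := ltP (ratr q : R) (- N%:R).
    have -> : `]ratr q, +oo[%classic `&` window N = window N.
      apply/seteqP; split=> x; rewrite /window/= !in_itv/= andbT; first by case.
      by move=> /andP[? ?]; split; lra.
    exact: X_window.
  have -> : `]ratr q, +oo[%classic `&` window N = `]ratr q, N%:R]%classic.
    apply/seteqP; split=> x; rewrite /window/= !in_itv/= andbT.
      by move=> [-> /andP[_ ->]].
    by move=> /andP[qx ->]; split; rewrite // andbT; lra.
  rewrite len_itv; last exact: ltW.
  by apply: X_rat; rewrite ltW.
- move=> S mS XS; have mSC : measurable (~` S) by exact: measurableC.
  have SU : (S `&` window N) `|` (~` S `&` window N) = window N.
    by rewrite -setIUl setUv setTI.
  have SI : (S `&` window N) `&` (~` S `&` window N) = set0.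
    by rewrite setIACA setICr set0I.
  have := XU (measurableI _ _ mS mw) (measurableI _ _ mSC mw) SI.
  rewrite SU => /(_ (bounded_set_itv _ _)).
  apply: filterS3 XS (X_window N) => w -> ->.
  rewrite -[in X in len X * _]SU lenU ?mulrDl//; try exact: measurableI; try exact: fw.
  by move/addrI.
- move=> F mF tF XF.
  have mFw n : measurable (F n `&` window N) by exact: measurableI.
  have tFw : trivIset setT (fun n => F n `&` window N).
    by apply: trivIset_setIr.
  have mUF : measurable (\bigcup_n F n) by exact: bigcup_measurable.
  have := X_series mFw tFw; have := len_series mFw tFw.
  rewrite -setI_bigcupl => /(_ (fw _ mUF)) lenF /(_ (bw _)).
  have {}XF : {ae P, forall w, forall n, X (F n `&` window N) w 0 i =
      len (F n `&` window N) * c 0 i} by apply/ae_foralln.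
  apply: filterS2 XF => w XFw XUw.
  apply: (cvg_unique _ XUw); first exact: Rhausdorff.
  have -> : series (fun n => X (F n `&` window N) w 0 i) =
      (fun n => series (len \o (fun n => F n `&` window N)) n * c 0 i).
    by apply/funext => n; rewrite /series/= mulr_suml; apply: eq_bigr => k _.
  by apply: cvgM lenF _; exact: cvg_cst.
Qed.

Lemma random_measure_dirac (B : set R) : measurable B -> bounded_set B ->
  {ae P, forall w, X B w 0 i = len B * c 0 i}.
Proof.
move=> mB [M [_ /(_ (`|M| + 1))]].
rewrite (le_lt_trans (ler_norm _)) ?ltrDl// => /(_ isT) BM.
pose N := (Num.truncn (`|M| + 1)).+1.
have := X_borel_window N mB.
have -> // : B `&` window N = B.
apply: setIidl => x /BM /= xM; rewrite /window/= in_itv/=.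
have := truncnS_gt (`|M| + 1); rewrite -/N; move: xM; rewrite ler_norml; lra.
Qed.

End deterministic.

(** * Limits in probability of constants *)

Section cvg_in_probability_cst.
Context {R : realType} {d : nat} {disp : measure_display}.
Context {Omega : measurableType disp} {P : probability Omega R}.
Local Notation V := 'rV[R]_d.

(** A vector is longer than e when one of its coordinates is, which leaves
    differences of real random variables. *)
Lemma measurable_dist (Y Z : Omega -> V) (e : R) : 0 < e ->
  (forall k, measurable_fun setT (fun w => Y w 0 k)) ->
  (forall k, measurable_fun setT (fun w => Z w 0 k)) ->
  measurable [set w | e < `|Y w - Z w|].
Proof.
move=> e0 mY mZ.
have -> : [set w | e < `|Y w - Z w|] =
    \bigcup_(k in [set: 'I_d]) [set w | e < `|Y w 0 k - Z w 0 k|].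
  apply/seteqP; split=> w /=; rewrite mx_norm_gtP//.
    by move=> /existsP[k]; rewrite !mxE; exists k.
  by move=> [k _ /= ek]; apply/existsP; exists k; rewrite !mxE.
apply: fin_bigcup_measurable => // k _.
have mD : measurable_fun setT (fun w => `|Y w 0 k - Z w 0 k|).
  by apply: measurableT_comp => //; exact: measurable_funB.
have := mD measurableT _ (measurable_itv `]e, +oo[).
rewrite setTI; congr measurable; apply/seteqP; split=> w /=;
  by rewrite in_itv/= andbT.
Qed.

(** Two of the events where Y i is further than e/4 from Z have probability less
    than 1/2 each, so some point avoids both and |a i - a j| <= e/2: the a i are
    Cauchy. *)
Lemma cvg_in_probability_cst (I : Type) (F : set_system I) (FF : ProperFilter F)
    (Y : I -> Omega -> V) (Z : Omega -> V) (a : I -> R) (k : 'I_d) :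
  (forall i l, measurable_fun setT (fun w => Y i w 0 l)) ->
  (forall l, measurable_fun setT (fun w => Z w 0 l)) ->
  (\forall i \near F, {ae P, forall w, Y i w 0 k = a i}) ->
  cvg_in_probability P F Y Z ->
  exists2 l, a @ F --> l & {ae P, forall w, Z w 0 k = l}.
Proof.
move=> mY mZ Ya YZ.
pose D e i := [set w | e < `|Y i w - Z w|].
have mD e i : 0 < e -> measurable (D e i) by move=> e0; exact: measurable_dist.
have Dsmall e r : 0 < e -> 0 < r -> \forall i \near F, (P (D e i) < r%:E)%E.
  move=> e0 r0; have /fine_cvgP[fD /cvgrPdist_lt/(_ r r0)] := YZ e e0.
  apply: filterS2 fD => i fi; rewrite sub0r normrN /= => Pr.
  by rewrite -(fineK fi) lte_fin (le_lt_trans (ler_norm _)).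
have Dcoord e i w : ~ D e i w -> `|Y i w 0 k - Z w 0 k| <= e.
  move/negP; rewrite -leNgt; apply: le_trans.
  by have := mx_norm_coord (Y i w - Z w) k; rewrite !mxE.
have ca : cauchy (a @ F).
  apply/cauchy_ballP => e e0.
  pose e' := e / 4%:R; have e4 : 0 < e' by rewrite divr_gt0.
  pose good i := (P (D e' i) < (2^-1)%:E)%E /\ {ae P, forall w, Y i w 0 k = a i}.
  have G : \forall i \near F, good i.
    by apply: filterI => //; apply: Dsmall => //; rewrite invr_gt0.
  exists (a @` good, a @` good) => /=.
    by split; apply: filterS G => i Gi; exists i.
  move=> [_ _] /= [[i [Di Yi] <-] [j [Dj Yj] <-]].
  apply: contrapT => aij.
  have : {ae P, forall w, (D e' i `|` D e' j) w}.
    apply: filterS2 Yi Yj => w Yi Yj; apply: contrapT => /not_orP[nDi nDj].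
    apply: aij; rewrite /ball/= -Yi -Yj.
    have := Dcoord _ _ _ nDi; have := Dcoord _ _ _ nDj.
    have := ler_normB (Y i w 0 k - Z w 0 k) (Y j w 0 k - Z w 0 k).
    rewrite opprB addrA subrK /e'; lra.
  move=> /(ae_prob1 (measurableU _ _ (mD _ i e4) (mD _ j e4))) D1.
  have := measureU2 P (mD _ i e4) (mD _ j e4).
  rewrite [X in (X <= _)%E]D1 leNgt => /negP; apply.
  by rewrite [ltRHS](_ : _ = (2^-1)%:E + (2^-1)%:E)%E ?lteD// -EFinD; congr EFin; lra.
have [l al] : exists l : R, a @ F --> l.
  by exists (lim (a @ F)); exact: R_complete.
exists l => //.
have Zl n : {ae P, forall w, `|Z w 0 k - l| <= n.+1%:R^-1}.
  have n0 : 0 < (n.+1%:R^-1 : R) / 2%:R by rewrite divr_gt0// invr_gt0.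
  have mA : measurable [set w | `|Z w 0 k - l| <= n.+1%:R^-1].
    have mZl : measurable_fun setT (fun w => `|Z w 0 k - l|).
      by apply: measurableT_comp => //; exact: measurable_funB.
    have := mZl measurableT _ (measurable_itv `]-oo, n.+1%:R^-1]).
    by rewrite setTI; congr measurable; apply/seteqP; split=> w /=; rewrite in_itv.
  apply/negligibleP; first exact: measurableC.
  apply/eqP; rewrite eq_le measure_ge0 andbT; apply/lee_addgt0Pr => r r0.
  rewrite add0e; move/cvgrPdist_le/(_ _ n0) : al => al.
  have [i [[Yi Dr] li]] := filter_ex (filterI (filterI Ya (Dsmall _ _ n0 r0)) al).
  apply: le_trans (ltW Dr); apply: le_prob_ae.
  - exact: measurableC.
  - exact: mD.
  apply: filterS Yi => w Yi /= nZl; apply: contrapT => /Dcoord; rewrite Yi => aZ.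
  apply: nZl; have := ler_normD (Z w 0 k - a i) (a i - l).
  rewrite addrA subrK (distrC (Z w 0 k) (a i)) (distrC (a i) l).
  move=> /le_trans; apply; rewrite [leRHS](splitr n.+1%:R^-1).
  by apply: lerD.
have : {ae P, forall w, forall n, `|Z w 0 k - l| <= n.+1%:R^-1} by apply/ae_foralln.
apply: filterS => w Zw; apply/eqP; rewrite -subr_eq0 -normr_le0.
apply/ler_addgt0Pr => e e0; rewrite add0r.
have [N _ /(_ N (leqnn N))/= Ne] := near_infty_natSinv_lt (PosNum e0).
exact: le_trans (Zw N) (ltW Ne).
Qed.

End cvg_in_probability_cst.

(** * Integrals of simple functions *)

Section simple_integral.
Context {R : realType} (a b : \bar R).
Local Notation leb := (@lebesgue_measure R).

Lemma sf_fun_measurable (g : simple_function a b) : measurable_fun setT (sf_fun g).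
Proof.
rewrite /sf_fun; apply: measurable_sum => j.
apply: measurable_funM => //; apply: measurable_indic; exact: sf_measurable.
Qed.

Lemma sf_fun_bounded (g : simple_function a b) (s : R) :
  `|sf_fun g s| <= \sum_(j < sf_size g) `|sf_coef j|.
Proof.
apply: le_trans (ler_norm_sum _ _ _) _; apply: ler_sum => j _.
rewrite normrM ler_piMr// indicE; case: (_ \in _); rewrite ?normr1// normr0//.
Qed.

Lemma Rintegral_sf_fun (g : simple_function a b) (B : set R) :
  measurable B -> (leb B < +oo)%E ->
  \int[leb]_(x in B) sf_fun g x =
  \sum_(j < sf_size g) sf_coef j * len (B `&` sf_set j).
Proof.
move=> mB Bfin.
pose u j x : R := sf_coef j * \1_(sf_set (s := g) j) x.
have mu_ j : measurable_fun B (u j).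
  apply: measurable_funM => //; apply: measurable_indic; exact: sf_measurable.
have bu j x : `|u j x| <= `|sf_coef j|.
  rewrite normrM ler_piMr// indicE; case: (_ \in _); rewrite ?normr1// normr0//.
have iu j : leb.-integrable B (EFin \o u j).
  apply: (@bounded_integrable _ _ _ leb B _ `|sf_coef j|); 
    [exact: mB|exact: Bfin|exact: mu_|by move=> x _; exact: bu].
have Iu j : \int[leb]_(x in B) u j x = sf_coef j * len (B `&` sf_set j).
  rewrite RintegralZl//; last first.
    apply: (@bounded_integrable _ _ _ leb B _ 1) => //.
      by apply: measurable_indic; exact: sf_measurable.
    by move=> x _; rewrite indicE; case: (_ \in _); rewrite ?normr1// normr0.
  rewrite /Rintegral integral_indic//; last exact: sf_measurable.
  by rewrite setIC.
rewrite /sf_fun -(eq_bigr _ (fun j _ => Iu j)).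
elim: (index_enum _) => [|j s IH].
  under eq_Rintegral do rewrite big_nil.
  by rewrite Rintegral_cst// mul0r big_nil.
under eq_Rintegral do rewrite big_cons.
rewrite big_cons -IH RintegralD//; first exact: iu.
have ms : measurable_fun B (fun x => \sum_(j <- s) u j x) by exact: measurable_sum.
apply: (@bounded_integrable _ _ _ leb B _ (\sum_(j <- s) `|sf_coef j|));
  [exact: mB|exact: Bfin|exact: ms|].
by move=> x _; apply: le_trans (ler_norm_sum _ _ _) _; apply: ler_sum => k _; exact: bu.
Qed.

End simple_integral.

(** * Sawtooth functions and their slopes *)

Section sawtooth.
Context {R : realType} (y : nat -> R).
Local Notation leb := (@lebesgue_measure R).

Definition rising : set R := \bigcup_n `]y n, (y n + y n.+1) / 2%:R]%classic.

Definition slope (s : R) : R := 2%:R * \1_rising s - 1.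

Definition primitive (p q : R) : R := \int[leb]_(s in `]p, q]) slope s.

Lemma measurable_rising : measurable rising.
Proof. by apply: bigcup_measurable => n _; exact: measurable_itv. Qed.

Lemma measurable_slope (D : set R) : measurable_fun D slope.
Proof.
apply: measurable_funB => //; apply: measurable_funM => //.
exact: measurable_indic measurable_rising.
Qed.

Lemma slope_rising s : rising s -> slope s = 1.
Proof. by move=> Ss; rewrite /slope indicE mem_set// mulr1 -addrA subrr addr0. Qed.

Lemma slope_falling s : ~ rising s -> slope s = -1.
Proof. by move=> Ss; rewrite /slope indicE memNset// mulr0 sub0r. Qed.

Lemma normr_slope s : `|slope s| = 1.
Proof.
have [Ss|Ss] := pselect (rising s); first by rewrite slope_rising ?normr1.
by rewrite slope_falling// normrN normr1.
Qed.

Lemma itvoc_lty (p q : R) : (leb `]p, q] < +oo)%E.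
Proof.
by rewrite -ge0_fin_numE//; apply: bounded_fin_num => //; exact: bounded_set_itv.
Qed.

Lemma integrable_slope (D : set R) : measurable D -> (leb D < +oo)%E ->
  leb.-integrable D (EFin \o slope).
Proof.
move=> mD Dfin; apply: (@bounded_integrable _ _ _ leb D _ 1) => //.
  exact: measurable_slope.
by move=> x _; rewrite normr_slope.
Qed.

Lemma primitive_chasles p q r : p <= q -> q <= r ->
  primitive p r = primitive p q + primitive q r.
Proof.
move=> pq qr; rewrite /primitive -(itvocU pq qr) Rintegral_setU//.
  by rewrite itvocU//; apply: integrable_slope => //; exact: itvoc_lty.
by rewrite disj_set2E itvocI.
Qed.

Lemma primitive_le p q : p <= q -> `|primitive p q| <= q - p.
Proof.
move=> pq; rewrite -(len_itv pq) -[leRHS]mul1r.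
apply: (Rintegral_le_bound (mu := leb)) => //.
- exact: itvoc_lty.
- exact: measurable_slope.
- by move=> x _; rewrite normr_slope.
Qed.

Lemma primitive_cst p q v : p <= q -> (forall s, p < s <= q -> slope s = v) ->
  primitive p q = v * (q - p).
Proof.
move=> pq pqv; rewrite -(len_itv pq) -(@Rintegral_cst _ _ _ leb)//.
by apply: eq_Rintegral => s; rewrite inE /= in_itv/=; exact: pqv.
Qed.

Hypothesis ynd : nondecreasing_seq y.
Hypothesis y0 : 0 <= y 0%N.
Hypothesis yoo : forall M, exists n, M < y n.

Let mid n := (y n + y n.+1) / 2%:R.

Let y_mid n : y n <= mid n. Proof. by have := ynd (leqnSn n); rewrite /mid; lra. Qed.
Let mid_y n : mid n <= y n.+1. Proof. by have := ynd (leqnSn n); rewrite /mid; lra. Qed.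

Let rise n : primitive (y n) (mid n) = mid n - y n.
Proof.
rewrite (primitive_cst (v := 1)) ?mul1r// => s ys; apply: slope_rising.
by exists n => //=; rewrite in_itv.
Qed.

Let fall n : primitive (mid n) (y n.+1) = - (y n.+1 - mid n).
Proof.
rewrite (primitive_cst (v := -1)) ?mulN1r// => s /andP[ms sy]; apply: slope_falling.
move=> [k _ /=]; rewrite in_itv/= -/(mid k) => /andP[ks sk].
have [kn|nk|kn] := ltngtP k n.
- by have := ynd kn; have := mid_y k; have := y_mid n; lra.
- by have := ynd nk; lra.
- by move: sk; rewrite kn; lra.
Qed.

Lemma primitive_tooth n : primitive (y n) (y n.+1) = 0.
Proof.
by rewrite (primitive_chasles (y_mid n) (mid_y n)) rise fall /mid; lra.
Qed.

Lemma primitive_node n : primitive 0 (y n) = - y 0%N.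
Proof.
have yn k : 0 <= y k by rewrite (le_trans y0)// ynd.
elim: n => [|n IH]; last first.
  by rewrite (primitive_chasles (yn n) (ynd (leqnSn n))) IH primitive_tooth addr0.
rewrite (primitive_cst (v := -1)) ?subr0 ?mulN1r// => s /andP[_ sy].
apply: slope_falling => -[k _ /=]; rewrite in_itv/= => /andP[ks _].
by have := ynd (leq0n k); lra.
Qed.

Lemma primitive_half n : primitive 0 (mid n) = (y n.+1 - y n) / 2%:R - y 0%N.
Proof.
have yn : 0 <= y n by rewrite (le_trans y0)// ynd.
by rewrite (primitive_chasles yn (y_mid n)) primitive_node rise /mid; lra.
Qed.

Lemma tooth_of q N : y N <= q -> exists n, [/\ (N <= n)%N, y n <= q & q < y n.+1].
Proof.
move=> yNq; have ex : exists n, q < y n by exact: yoo.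
have [[|m] qm mmin] := ex_minnP ex.
  by have := ynd (leq0n N); lra.
have ym : y m <= q.
  by rewrite leNgt; apply/negP => /mmin; rewrite ltnn.
exists m; split => //; rewrite leqNgt; apply/negP => mN.
by have := ynd mN; lra.
Qed.

(** Between two nodes the primitive differs from its value -y_0 at the nodes by
    at most their distance. *)
Lemma primitive_cvg : y n.+1 - y n @[n --> \oo] --> 0 ->
  forall e, 0 < e -> exists Q, forall q, Q <= q -> `|primitive 0 q + y 0%N| <= e.
Proof.
move=> gap e e0; move/cvgrPdist_le/(_ e e0) : gap => [N _ Ngap].
exists (y N) => q /tooth_of[n [Nn ynq qyn]].
have yn : 0 <= y n by rewrite (le_trans y0)// ynd.
rewrite (primitive_chasles yn ynq) primitive_node addrAC addNr add0r.
apply: le_trans (primitive_le ynq) _.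
have := Ngap n Nn; rewrite sub0r normrN.
by move/(le_trans (ler_norm _)); lra.
Qed.

End sawtooth.

(** * The random measure of a point mass *)

Section deterministic_random_measure.
Context {R : realType} {d : nat} {disp : measure_display}.
Context {Omega : measurableType disp} (P : probability Omega R).
Local Notation V := 'rV[R]_d.
Local Notation leb := (@lebesgue_measure R).

(** Translating and then measuring is a measure that agrees with Lebesgue
    measure on intervals. *)
Lemma lebesgue_measureD (B : set R) (t : R) : measurable B ->
  leb [set s + t | s in B] = leb B.
Proof.
move=> mB.
have mT u : measurable_fun setT (fun s : R => s + u) by exact: measurable_funD.
have mT' : @measurable_fun _ _ (measurableTypeR R) (measurableTypeR R)
  setT (fun s : R => s + t) := mT t.
have imE (A : set R) : [set s + t | s in A] = (fun s => s - t) @^-1` A.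
  apply/seteqP; split=> [_ [s As <-]|s As] /=; first by rewrite addrK.
  by exists (s - t); rewrite ?subrK.
have mBt : measurable [set s + t | s in B].
  by rewrite imE -[X in measurable X]setTI; exact: (mT (- t)).
pose m := pushforward leb (fun s : R => s + t).
have mE : m [set s + t | s in B] = leb B.
  by congr leb; apply/seteqP; split=> [s [r Br] /addIr <-//|s Bs]; exists s.
rewrite -mE.
pose m' : {measure set (measurableTypeR R) -> \bar R} :=
  measure_function_pushforward__canonical__measure_function_Measure leb mT'.
suff : forall X, ocitv X -> leb X = m' X.
  by move=> /(@lebesgue_measure_unique R m')/(_ _ mBt).
move=> _ [[a b] _ <-]; rewrite -[RHS]/(leb ((fun s => s + t) @^-1` `]a, b]%classic)).
have -> : (fun s => s + t) @^-1` `]a, b]%classic = `]a - t, b - t]%classic.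
  by apply/seteqP; split=> s; rewrite /= !in_itv/=; lra.
rewrite !lebesgue_measure_itv/= !lte_fin ltrD2r; case: ifP => // _.
by rewrite -!EFinB; congr EFin; lra.
Qed.

Definition length_times (c : V) (B : set R) : {RV P >-> V} := cst (len B *: c).

Lemma cst_preimage (v : V) (A : set V) : (cst v : Omega -> V) @^-1` A =
  if v \in A then setT else set0.
Proof.
by case: ifPn; rewrite (inE, notin_setE) => vA; apply/seteqP; split=> w.
Qed.

Lemma prob_cst (v : V) (A : set V) : P ((cst v : Omega -> V) @^-1` A) = \d_v A.
Proof.
rewrite cst_preimage diracE.
by case: (v \in A); rewrite ?probability_setT ?measure0.
Qed.

Lemma length_times_random_measure (c : V) :
  random_measure (\d_c : probability V R) (length_times c).
Proof.
split.
- move=> B mB tB bB; apply: aeW => w /=.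
  have H := len_series mB tB (bounded_fin_num (bigcup_measurable (fun k _ => mB k)) bB).
  have -> : series (fun n => len (B n) *: c) = (fun n => series (len \o B) n *: c).
    by apply/funext => n; rewrite /series/= scaler_suml.
  exact: cvgZr_tmp.
- move=> n B mB tB A mA.
  have PA k : P (length_times c (B k) @^-1` A k) = \d_(len (B k) *: c) (A k).
    exact: prob_cst.
  rewrite (eq_bigr _ (fun k _ => PA k)).
  have [AB|/existsNP[k nA]] := pselect (forall k, A k (len (B k) *: c)).
    rewrite big1 => [|k _]; last by rewrite diracE mem_set.
    by rewrite -[RHS](probability_setT P); congr (P _); apply/seteqP; split.
  rewrite (bigD1 k)//= diracE memNset// mul0e -[RHS](measure0 P).
  by congr (P _); rewrite -subset0 => w /(_ k).
- move=> t; apply: aeW => w; rewrite /length_times/= /cst /len.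
  by rewrite lebesgue_measure_set1 scale0r.
- move=> B t mB bB A mA.
  rewrite [LHS](prob_cst (len [set s + t | s in B] *: c) A).
  rewrite [RHS](prob_cst (len B *: c) A).
  by rewrite /len lebesgue_measureD.
- move=> t A mA; rewrite [LHS](prob_cst (len `]t, t + 1] *: c) A).
  by rewrite len_itv ?lerDl// addrAC subrr add0r scale1r.
Qed.

End deterministic_random_measure.

(** * Point masses are infinitely divisible *)

Section dirac_infinitely_divisible.
Context {R : realType} {d : nat}.
Local Notation V := 'rV[R]_d.

Lemma measurable_translate (x : V) (A : set V) : measurable A ->
  measurable [set y | A (x + y)].
Proof.
have : measurable_fun setT (fun y : V => x + y).
  apply: (@measurability _ _ _ _ _ _ (@open V)) => // _ [U oU <-].
  rewrite setTI; apply: sub_sigma_algebra; apply: open_comp => // y _.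
  by apply: continuousD; [exact: cst_continuous|exact: cvg_id].
by move=> mx mA; rewrite -[X in measurable X]setTI; exact: mx.
Qed.

Lemma dirac_convolution_power (v : V) n (A : set V) : measurable A ->
  convolution_power (\d_v : probability V R) n A = \d_(v *+ n) A.
Proof.
elim: n A => [|n IH] A mA //.
rewrite /convolution_power iterS -/(convolution_power _ n) /convolution.
rewrite (eq_integral (fun x => (\1_[set x | A (x + v *+ n)] x)%:E)); last first.
  move=> x _; rewrite IH; last exact: measurable_translate.
  by rewrite diracE indicE; congr ((nat_of_bool _)%:R%:E); apply/idP/idP; rewrite !inE.
have mAn : measurable [set x | A (x + v *+ n)].
  have := measurable_translate (v *+ n) mA.
  by congr measurable; apply/seteqP; split=> x /=; rewrite addrC.
rewrite integral_indic// setIT.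
by rewrite !diracE mulrS; congr ((nat_of_bool _)%:R%:E); apply/idP/idP; rewrite !inE.
Qed.

Lemma dirac_ID (v : V) : ID (\d_v : probability V R).
Proof.
move=> n n0; exists (\d_(n%:R^-1 *: v)) => A mA.
rewrite dirac_convolution_power// -scaler_nat scalerA divff ?scale1r//.
by rewrite pnatr_eq0 -lt0n.
Qed.

End dirac_infinitely_divisible.

(** * The tau-measure of a slope *)

Section sawtooth_integral.
Context {R : realType} (y : nat -> R).
Local Notation leb := (@lebesgue_measure R).
Local Notation half_line := (@oint R 0%:E +oo%E).

Lemma half_lineE : half_line = `]0, +oo[%classic.
Proof.
by apply/seteqP; split=> s; rewrite /oint/= in_itv/= andbT lte_fin ltry; [case|].
Qed.

Lemma measurable_half_line : measurable half_line.
Proof. by rewrite half_lineE; exact: measurable_itv. Qed.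

Definition branch (j : 'I_2) : set R :=
  half_line `&` (if j == 0 then rising y else ~` rising y).

Lemma measurable_branch j : measurable (branch j).
Proof.
apply: measurableI; first exact: measurable_half_line.
by case: ifP => _; [|apply: measurableC]; exact: measurable_rising.
Qed.

Lemma branch_sub j : branch j `<=` half_line.
Proof. by move=> s []. Qed.

Lemma branch_disjoint : trivIset setT branch.
Proof.
apply/trivIsetP => i j _ _ ij; rewrite -subset0 /branch.
case: i j ij => [[|[|//]] i2] [[|[|//]] j2] //= _.
- by move=> s [[_ Ss] [_ /= /(_ Ss)]].
- by move=> s [[_ /= nSs] [_ /nSs]].
Qed.

(** A slope takes two values, so on the half-line it is itself a simple function
    and serves as its own approximating sequence. *)
Definition slope_sf : simple_function 0%:E +oo%E :=
  @SimpleFunction R 0%:E +oo%E 2 (fun j => if j == 0 then 1 else - 1) branch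
    measurable_branch branch_sub branch_disjoint.

Lemma slope_sfE s : half_line s -> sf_fun slope_sf s = slope y s.
Proof.
move=> s0; rewrite /sf_fun !big_ord_recl big_ord0/= addr0 mul1r mulN1r !indicE.
have [Ss|Ss] := pselect (rising y s).
  rewrite slope_rising// mem_set; last by split.
  by rewrite memNset ?subr0//= => -[_] /=.
rewrite slope_falling// memNset; last by case.
by rewrite mem_set ?sub0r.
Qed.

Lemma Rintegral_slope (B : set R) : measurable B -> (leb B < +oo)%E ->
  B `<=` half_line ->
  \int[leb]_(x in B) slope y x = len (B `&` branch 0) - len (B `&` branch 1).
Proof.
move=> mB Bfin B0.
rewrite (@eq_Rintegral _ _ _ leb B (sf_fun slope_sf)); last first.
  by move=> s; rewrite inE => /B0/slope_sfE.
rewrite Rintegral_sf_fun// !big_ord_recl big_ord0/= addr0 mul1r mulN1r.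
by congr (_ - len (_ `&` branch _)); apply/val_inj.
Qed.

Hypothesis ynd : nondecreasing_seq y.
Hypothesis y0 : 0 <= y 0%N.
Hypothesis yoo : forall M, exists n, M < y n.

(** The two lengths have sum y_n and difference -y_0. *)
Lemma len_branch n :
  len (`]0, y n] `&` branch 0) = (y n - y 0%N) / 2%:R /\
  len (`]0, y n] `&` branch 1) = (y n + y 0%N) / 2%:R.
Proof.
have yn : 0 <= y n by rewrite (le_trans y0)// ynd.
have sub : `]0, y n]%classic `<=` half_line.
  by rewrite half_lineE => s; rewrite /= !in_itv/= andbT => /andP[].
have mB : measurable `]0, y n]%classic by exact: measurable_itv.
have Bfin := itvoc_lty 0 (y n).
have := Rintegral_slope mB Bfin sub; rewrite -/(primitive y 0 (y n)).
rewrite (primitive_node ynd)//.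
have mb j : measurable (`]0, y n] `&` branch j).
  by apply: measurableI => //; exact: measurable_branch.
have fb j : leb (`]0, y n] `&` branch j) \is a fin_num.
  apply: bounded_fin_num => //.
  exact: bounded_set_sub (@subIsetl _ _ _) (bounded_set_itv _ _).
have : len `]0, y n] = len (`]0, y n] `&` branch 0) + len (`]0, y n] `&` branch 1).
  rewrite -lenU//; last first.
    rewrite setIACA (trivIsetP.1 branch_disjoint 0 1) ?setI0//.
  congr len; rewrite -setIUr; apply/esym/setIidl => s /sub s0.
  by rewrite /branch/=; have [Ss|nSs] := pselect (rising y s); [left|right].
rewrite len_itv// subr0; lra.
Qed.

(** By [len_branch], each value is taken on a part of (0, y_n] whose length grows
    without bound with n. *)
Lemma branch_infinite j : leb (branch j) = +oo%E.
Proof.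
apply/eqP; rewrite -leye_eq leNgt; apply/negP => bfin.
have [n yn] := yoo (2%:R * fine (leb (branch j)) + y 0%N).
have mb := measurable_branch j.
have : len (`]0, y n] `&` branch j) <= fine (leb (branch j)).
  have le : (leb (`]0%R, y n] `&` branch j) <= leb (branch j))%E.
    by apply: le_measure; rewrite ?inE//; exact: measurableI.
  by apply: fine_le => //; rewrite ge0_fin_numE// (le_lt_trans le).
have [b0 b1] := len_branch n.
have [j0|j1] : j = 0 \/ j = 1.
- by case: j {bfin yn mb} => [[|[|//]] j2]; [left|right]; apply/val_inj.
- by move: yn; rewrite j0 b0; lra.
- by move: yn; rewrite j1 b1; have := y0; lra.
Qed.

Lemma tau_slope (B : set R) : measurable B ->
  tau 0%:E +oo%E (slope y) B = if `[< B 1 \/ B (-1) >] then +oo%E else 0%E.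
Proof.
move=> mB.
have mfB : measurable (slope y @^-1` B).
  by have := @measurable_slope R y setT measurableT B mB; rewrite setTI.
rewrite /tau integral_indic//; last exact: measurable_half_line.
have big (j : 'I_2) : B (if j == 0 then 1 else -1) ->
    leb (slope y @^-1` B `&` half_line) = +oo%E.
  move=> Bj; apply/eqP; rewrite -leye_eq -[leLHS](branch_infinite j).
  apply: le_measure; rewrite ?inE.
  - exact: measurable_branch.
  - exact: (measurableI _ _ mfB measurable_half_line).
  move=> s [s0 js]; split=> //=; case: ifPn js Bj => _.
  - by move=> /slope_rising ->.
  - by move=> /slope_falling ->.
case: asboolP => [[B1|BN1]|nB].
- exact: (big 0).
- exact: (big 1).
rewrite (_ : _ `&` _ = set0) ?measure0// -subset0 => s [/= Bs _].
apply: nB; have [Ss|nSs] := pselect (rising y s).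
- by left; rewrite -(slope_rising Ss).
- by right; rewrite -(slope_falling nSs).
Qed.

End sawtooth_integral.

(** * The filter of end points *)

Section endpoints_filter.
Context {R : realType}.
Local Notation E := (@endpoints R 0%:E +oo%E).

Lemma endpoints_near (e Q : R) : 0 < e ->
  \forall u \near E, [/\ 0 < u.1, u.1 <= e, u.1 < u.2 & Q <= u.2].
Proof.
move=> e0; exists (e, Num.max (e + 1) Q).
  by split => /=; rewrite ?lte_fin ?ltry// lt_max ltrDl ltr01.
move=> [p q] [/= p0 pe Qq _]; move: Qq; rewrite ge_max => /andP[eq Qq].
by split => //; lra.
Qed.

Global Instance endpoints_proper : ProperFilter E.
Proof.
apply: filter_from_proper; last first.
  by move=> [p q] [/= p0 pq qoo]; exists (p, q).
apply: filter_from_filter.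
  by exists (1, 2%:R); split; rewrite /= ?lte_fin ?ltr01 ?ltry ?ltr1n.
move=> [p q] [p' q'] [/= p0 pq qoo] [/= p0' pq' qoo'].
exists (Num.min p p', Num.max q q').
  split => /=; rewrite ?lte_fin ?ltry// ?lt_min.
    by rewrite -!lte_fin p0.
  by rewrite lt_max gt_min pq.
move=> [a b] /= [a0]; rewrite le_min ge_max => /andP[ap ap'] /andP[qb qb'] boo.
by split.
Qed.

End endpoints_filter.

(** * Integrals of a slope against a deterministic random measure *)

Section integral_wrt_length.
Context {R : realType} {d : nat} (y : nat -> R).
Local Notation V := 'rV[R]_d.
Local Notation leb := (@lebesgue_measure R).
Local Notation E := (@endpoints R 0%:E +oo%E).

Lemma inner_borel_half_line (p q : R) (B : set R) : 0 < p -> measurable B ->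
  B `<=` `]p, q]%classic -> inner_borel 0%:E +oo%E B.
Proof.
move=> p0 mB Bpq; split => //.
- by move=> s /Bpq; rewrite half_lineE /= !in_itv/= andbT => /andP[/(lt_trans p0)].
- apply: (@lt_le_trans _ _ p%:E); first by rewrite lte_fin.
  apply: le_ereal_inf_tmp => _ [s /Bpq/= + <-].
  by rewrite in_itv/= lee_fin => /andP[/ltW].
- apply: (@le_lt_trans _ _ q%:E); last by rewrite ltry.
  apply: ge_ereal_sup => _ [s /Bpq/= + <-].
  by rewrite in_itv/= lee_fin => /andP[].
Qed.

Lemma primitive_endpoints (l : R) :
  (forall e, 0 < e -> exists Q, forall q, Q <= q -> `|primitive y 0 q - l| <= e) ->
  primitive y u.1 u.2 @[u --> E] --> l.
Proof.
move=> yl; apply/cvgrPdist_le => e e0.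
have e2 : 0 < e / 2%:R by rewrite divr_gt0.
have [Q Ql] := yl _ e2.
have := endpoints_near Q e2; apply: filterS => -[p q] [/= p0 pe pq Qq].
have := primitive_chasles y (ltW p0) (ltW pq).
have := primitive_le y (ltW p0); have := Ql q Qq; rewrite subr0 => ql p0l ch.
have -> : l - primitive y p q = (l - primitive y 0 q) + primitive y 0 p by lra.
apply: le_trans (ler_normD _ _) _; rewrite [leRHS]splitr distrC.
by apply: lerD => //; exact: le_trans pe.
Qed.

Lemma Rintegral_slope_itv (p q : R) : 0 <= p ->
  primitive y p q =
  len (`]p, q] `&` branch y 0) - len (`]p, q] `&` branch y 1).
Proof.
move=> p0; apply: Rintegral_slope; [exact: measurable_itv|exact: itvoc_lty|].
by rewrite half_lineE => s; rewrite /= !in_itv/= andbT => /andP[/(le_lt_trans p0)].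
Qed.

Section existence.
Context {disp : measure_display} {Omega : measurableType disp}.
Context (P : probability Omega R) (c : V).

Definition slope_integral (B : set R) : {RV P >-> V} :=
  cst ((len (B `&` branch y 0) - len (B `&` branch y 1)) *: c).

Lemma slope_is_integral :
  is_integral 0%:E +oo%E (length_times P c) (slope y) slope_integral.
Proof.
exists (fun=> slope_sf y); split.
  by apply: aeW => s /slope_sfE ->; exact: cvg_cst.
move=> B _ e e0; rewrite (_ : (fun _ => P _) = fun=> 0%E); first exact: cvg_cst.
apply/funext => n; rewrite (_ : [set w | _] = set0) ?measure0//.
rewrite -subset0 => w /=; rewrite /sf_integral !big_ord_recl big_ord0/= addr0.
rewrite scale1r scaleN1r -scalerBl.
have -> : lift ord0 ord0 = 1 :> 'I_2 by exact/val_inj.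
by rewrite subrr normr0 ltNge ltW.
Qed.

Lemma slope_is_improper_integral (l : R) :
  primitive y u.1 u.2 @[u --> E] --> l ->
  is_improper_integral 0%:E +oo%E (length_times P c) (slope y) (cst (l *: c)).
Proof.
move=> yl; exists slope_integral; first exact: slope_is_integral.
move=> e e0.
apply: cvg_near_cst.
have c1 : 0 < `|c| + 1 by rewrite ltr_wpDl.
have := endpoints_near 0 (ltr01 : 0 < 1 :> R).
move/cvgrPdist_le/(_ _ (divr_gt0 e0 c1)) : yl.
apply: filterS2 => -[p q] /= lpq [p0 _ pq _].
rewrite (_ : [set w | _] = set0) ?measure0// -subset0 => w /=.
rewrite -Rintegral_slope_itv; last exact: ltW.
rewrite -scalerBl normrZ ltNge => /negP; apply.
rewrite distrC; apply: (@le_trans _ _ (e / (`|c| + 1) * `|c|)).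
  by rewrite ler_wpM2r.
by rewrite mulrAC ler_pdivrMr// ler_pM2l// lerDl.
Qed.

End existence.

Section uniqueness.
Context {disp : measure_display} {Omega : measurableType disp}.
Context (P : probability Omega R) (c : V) (i : 'I_d) (ci : c 0 i = 1).
Context (X : set R -> {RV P >-> V}).
Context (Xc : random_measure (\d_c : probability V R) X).

Let mX (Y : {RV P >-> V}) k : measurable_fun setT (fun w => Y w 0 k).
Proof. by apply: (measurableT_comp (measurable_coord k)). Qed.

Let sf_integral_coord (g : simple_function (0%:E : \bar R) +oo%E) p q (B : set R) :
  measurable B -> B `<=` `]p, q]%classic ->
  {ae P, forall w, sf_integral X g B w 0 i = \int[leb]_(x in B) sf_fun g x}.
Proof.
move=> mB Bpq.
have bB : bounded_set B by exact: bounded_set_sub Bpq (bounded_set_itv p q).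
rewrite Rintegral_sf_fun//; last by rewrite -ge0_fin_numE//; exact: bounded_fin_num.
have mBj j : measurable (B `&` sf_set (s := g) j).
  by apply: measurableI => //; exact: sf_measurable.
have bBj j : bounded_set (B `&` sf_set (s := g) j).
  exact: bounded_set_sub (@subIsetl _ _ _) bB.
have : {ae P, forall w, forall j : 'I_(sf_size g),
    X (B `&` sf_set j) w 0 i = len (B `&` sf_set j)}.
  have H j : {ae P, forall w,
      X (B `&` sf_set (s := g) j) w 0 i = len (B `&` sf_set (s := g) j)}.
    have := random_measure_dirac Xc i (mBj j) (bBj j).
    by apply: filterS => w ->; rewrite ci mulr1.
  exact: filter_forall.
apply: filterS => w Xw; rewrite /sf_integral summxE; apply: eq_bigr => j _.
by rewrite mxE Xw.
Qed.

(** The integrals of the approximating simple functions over any Borel subset of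
    (p, q] are almost surely constant, so these constants converge, and
    [setwise_cvg_Rintegral0] identifies the limit over (p, q]. *)
Lemma is_integral_unique J p q : is_integral 0%:E +oo%E X (slope y) J ->
  0 < p -> p <= q -> {ae P, forall w, J `]p, q]%classic w 0 i = primitive y p q}.
Proof.
move=> [g [gy gJ]] p0 pq.
pose D : set R := `]p, q]%classic.
have mD : measurable D by exact: measurable_itv.
have Dfin : (leb D < +oo)%E by exact: itvoc_lty.
have D0 : D `<=` oint 0%:E +oo%E.
  by rewrite half_lineE => s; rewrite /D/= !in_itv/= andbT => /andP[/(lt_trans p0)].
have JB (B : set R) : measurable B -> B `<=` D -> exists2 l,
    \int[leb]_(x in B) sf_fun (g n) x @[n --> \oo] --> l &
    {ae P, forall w, J B w 0 i = l}.
  move=> mB BD.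
  apply: (@cvg_in_probability_cst _ _ _ _ P nat \oo _
            (fun n => sf_integral X (g n) B) (J B)).
  - move=> n k; rewrite (_ : (fun w => _) = fun w =>
      \sum_(j < sf_size (g n)) sf_coef j * X (B `&` sf_set j) w 0 k).
      by apply: measurable_sum => j; apply: measurable_funM => //; exact: mX.
    apply/funext => w; rewrite /sf_integral summxE; apply: eq_bigr => j _.
    by rewrite mxE.
  - by move=> k; exact: mX.
  - by apply: nearW => n; exact: sf_integral_coord BD.
  - exact: gJ (inner_borel_half_line p0 mB BD).
have [l Dl Jl] := JB D mD (@subset_refl _ D).
suff lE : l = primitive y p q by rewrite -lE.
pose h n x := sf_fun (g n) x - slope y x.
have mh n : measurable_fun D (h n).
  apply: measurable_funB; last exact: measurable_slope.
  exact: measurable_funS (@sf_fun_measurable _ _ _ _).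
have sub_lty (B : set R) : measurable B -> B `<=` D -> (leb B < +oo)%E.
  by move=> mB BD; apply: le_lt_trans Dfin; apply: le_measure; rewrite ?inE.
have hB (B : set R) n : measurable B -> B `<=` D -> \int[leb]_(x in B) h n x =
    \int[leb]_(x in B) sf_fun (g n) x - \int[leb]_(x in B) slope y x.
  move=> mB BD; rewrite RintegralB//.
  - apply: (@bounded_integrable _ _ _ leb B _ (\sum_(j < sf_size (g n)) `|sf_coef j|)).
    + exact: mB.
    + exact: sub_lty.
    + exact: measurable_funS (@sf_fun_measurable _ _ _ _).
    + by move=> x _; exact: sf_fun_bounded.
  - by apply: integrable_slope => //; exact: sub_lty.
have : \int[leb]_(x in D) h n x @[n --> \oo] --> 0.
  apply: setwise_cvg_Rintegral0 => //.
  - move=> n; exists (\sum_(j < sf_size (g n)) `|sf_coef j| + 1) => x _.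
    apply: le_trans (ler_normB _ _) _; rewrite normr_slope lerD2r.
    exact: sf_fun_bounded.
  - apply: (@filterS _ _ (ae_filter_ringOfSetsType leb)) gy => s gs Ds.
    rewrite -(subrr (slope y s)); apply: cvgB; last exact: cvg_cst.
    exact/gs/D0.
  - move=> B mB BD; have [m Bm _] := JB B mB BD.
    apply/cvg_ex; exists (m - \int[leb]_(x in B) slope y x).
    under eq_fun do rewrite hB//.
    by apply: cvgB => //; exact: cvg_cst.
under eq_fun do rewrite hB//.
have : \int[leb]_(x in D) sf_fun (g n) x - \int[leb]_(x in D) slope y x @[n --> \oo] -->
   l - \int[leb]_(x in D) slope y x by apply: cvgB => //; exact: cvg_cst.
move=> H1 H2; apply/eqP; rewrite -subr_eq0; apply/eqP.
by apply: (cvg_unique _ H1 H2); exact: Rhausdorff.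
Qed.

Lemma is_improper_integral_unique Z :
  is_improper_integral 0%:E +oo%E X (slope y) Z ->
  exists2 l, primitive y u.1 u.2 @[u --> E] --> l & {ae P, forall w, Z w 0 i = l}.
Proof.
move=> [J yJ JZ].
apply: (@cvg_in_probability_cst _ _ _ _ P _ E _
          (fun u => J `]u.1, u.2]%classic) Z _ i) JZ.
- by move=> u k; exact: mX.
- by move=> k; exact: mX.
have := endpoints_near 0 (ltr01 : 0 < 1 :> R).
apply: filterS => -[p q] [/= p0 _ pq _].
by apply: is_integral_unique => //; exact: ltW.
Qed.

End uniqueness.
End integral_wrt_length.

(** * The examples *)

Section examples.
Context {R : realType} {d : nat}.
Local Notation V := 'rV[R]_d.
Local Notation E := (@endpoints R 0%:E +oo%E).

(** The random measure is deterministic, so any probability space carries it;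
    the point mass at 0 on the real line is one. *)
Lemma slope_DPhi (y : nat -> R) (c : V) (l : R) :
  primitive y u.1 u.2 @[u --> E] --> l ->
  @DPhi R d 0%:E +oo%E (slope y) (\d_c).
Proof.
move=> yl; split; first exact: dirac_ID.
exists _, R, (\d_(0 : R) : probability R R), (length_times (\d_(0 : R)) c); split.
- exact: length_times_random_measure.
- split; first exact: measurable_slope.
  by exists (slope_integral y (\d_(0 : R)) c); exact: slope_is_integral.
- by exists (cst (l *: c)); exact: slope_is_improper_integral.
Qed.

Lemma DPhi_slope_cvg (y : nat -> R) (c : V) (i : 'I_d) : c 0 i = 1 ->
  @DPhi R d 0%:E +oo%E (slope y) (\d_c) ->
  exists l : R, primitive y u.1 u.2 @[u --> E] --> l.
Proof.
move=> ci [_ [disp [ Omega [P [X [Xc _ [Z XZ]]]]]]].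
by have [l yl _] := is_improper_integral_unique ci Xc XZ; exists l.
Qed.

(** [Phi] is chosen among the laws allowed by [is_Phi], each of which may come
    from a different version of the random measure; all of them give the
    coordinate i the value l. *)
Lemma Phi_slope (y : nat -> R) (c : V) (i : 'I_d) (l : R) : c 0 i = 1 ->
  primitive y u.1 u.2 @[u --> E] --> l ->
  Phi 0%:E +oo%E (slope y) (\d_c) [set v : V | v 0 i = l] = 1%E.
Proof.
move=> ci yl.
have mA : measurable [set v : V | v 0 i = l].
  by have := measurable_coord i measurableT (measurable_set1 l); rewrite setTI.
have [disp [ Omega [P [X [Z [Xc XZ PhiZ]]]]]] :
    is_Phi 0%:E +oo%E (slope y) (\d_c) (Phi 0%:E +oo%E (slope y) (\d_c)).
  apply: xgetPex; exists (\d_(l *: c) : probability V R).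
  exists _, R, (\d_(0 : R) : probability R R), (length_times (\d_(0 : R)) c),
    (cst (l *: c)); split.
  - exact: length_times_random_measure.
  - exact: slope_is_improper_integral.
  - by move=> A _; rewrite [RHS](prob_cst (\d_(0 : R)) (l *: c) A).
rewrite (PhiZ _ mA).
have [l' yl' Zl'] := is_improper_integral_unique ci Xc XZ.
have ll' : l = l' by apply: (cvg_unique _ yl yl'); exact: Rhausdorff.
have mZA : measurable (Z @^-1` [set v : V | v 0 i = l]).
  by rewrite -[X in measurable X]setTI; apply: measurable_funPT.
by apply: (ae_prob1 mZA); rewrite ll'.
Qed.

(** Nodes starting at c whose gaps 1/(n+1) tend to 0, while their sum
    diverges. *)
Definition shrinking (c : R) (n : nat) : R := c + series harmonic n.

Lemma shrinking_nondecreasing c : nondecreasing_seq (shrinking c).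
Proof.
move=> m n mn; rewrite lerD2l; apply: nondecreasing_series => // k _ _.
exact: harmonic_ge0.
Qed.

Lemma shrinking0 c : shrinking c 0 = c.
Proof. by rewrite /shrinking /series/= big_geq// addr0. Qed.

Lemma shrinking_unbounded c M : exists n, M < shrinking c n.
Proof.
apply: contrapT => /forallNP Mub; apply: (@dvg_harmonic R).
apply: nondecreasing_is_cvgn.
  by move=> m n mn; have := shrinking_nondecreasing c mn; rewrite lerD2l.
exists (M - c) => _ [n _ <-].
by have /negP := Mub n; rewrite -leNgt /shrinking; lra.
Qed.

Lemma shrinking_cvg c : 0 <= c ->
  primitive (shrinking c) u.1 u.2 @[u --> E] --> - c.
Proof.
move=> c0; apply: primitive_endpoints => e e0.
have gap : shrinking c n.+1 - shrinking c n @[n --> \oo] --> 0.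
  rewrite (_ : (fun n => _) = harmonic); first exact: cvg_harmonic.
  by apply/funext => n; rewrite /shrinking opprD addrACA subrr add0r seriesSB.
have c0' : 0 <= shrinking c 0 by rewrite shrinking0.
have [Q QP] := primitive_cvg (@shrinking_nondecreasing c) c0'
  (shrinking_unbounded c) gap e0.
by exists Q => q /QP; rewrite shrinking0 opprK.
Qed.

Definition even_node (n : nat) : R := n.*2%:R.

Lemma even_node_nondecreasing : nondecreasing_seq even_node.
Proof. by move=> m n mn; rewrite ler_nat leq_double. Qed.

Lemma even_node_unbounded M : exists n, M < even_node n.
Proof.
exists (Num.truncn `|M|).+1; apply: le_lt_trans (ler_norm M) _.
apply: lt_le_trans (truncnS_gt _) _.
by rewrite ler_nat -addnn leq_addr.
Qed.

(** Far out the primitive still takes the values 0 at 2n and 1 at 2n+1, so its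
    increments from a fixed p cannot both be within 1/4 of l. *)
Lemma even_node_dvg (l : R) : ~ primitive even_node u.1 u.2 @[u --> E] --> l.
Proof.
move=> /cvgrPdist_lt/(_ 4%:R^-1).
rewrite invr_gt0 ltr0n => /(_ isT) [[p q] [/= p0 pq _] near_l].
have [n qn] := even_node_unbounded q.
have n0 : 0 <= even_node n by rewrite ler0n.
pose m := (even_node n + even_node n.+1) / 2%:R.
have mE : m = even_node n + 1.
  by rewrite /m /even_node doubleS -addn2 natrD; lra.
have e0 : even_node 0 = 0 by [].
have far r : q <= r -> `|l - primitive even_node p r| < 4%:R^-1.
  by move=> qr; apply: (near_l (p, r)); split; rewrite /= ?ltry.
have Pn := primitive_node even_node_nondecreasing (lexx 0 : 0 <= even_node 0) n.
have Pm := primitive_half even_node_nondecreasing (lexx 0 : 0 <= even_node 0) n.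
have chn : primitive even_node 0 (even_node n) =
    primitive even_node 0 p + primitive even_node p (even_node n).
  by apply: primitive_chasles; rewrite -?lte_fin; [exact: ltW|lra].
have chm : primitive even_node 0 m =
    primitive even_node 0 p + primitive even_node p m.
  by apply: primitive_chasles; [exact: ltW|rewrite mE; lra].
have := far _ (ltW qn); have : q <= m by rewrite mE; lra.
move/far.
have gap : even_node n.+1 - even_node n = 2%:R.
  by rewrite /even_node doubleS -addn2 natrD addrAC subrr add0r.
move: Pn Pm chn chm; rewrite -/m gap e0 !ltr_norml.
lra.
Qed.

End examples.

Theorem proposition7p3 (R : realType) (d : nat) (d_gt0 : (0 < d)%N) :
  (exists f1 f2 : R -> R,
     [/\ measurable_fun (oint 0%:E +oo%E) f1,
         measurable_fun (oint 0%:E +oo%E) f2,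
         same_measure (tau 0%:E +oo%E f1) (tau 0%:E +oo%E f2) &
         @DPhi R d 0%:E +oo%E f1 <> @DPhi R d 0%:E +oo%E f2])
  /\
  (exists f1 f2 : R -> R,
     [/\ measurable_fun (oint 0%:E +oo%E) f1,
         measurable_fun (oint 0%:E +oo%E) f2,
         same_measure (tau 0%:E +oo%E f1) (tau 0%:E +oo%E f2) &
         exists mu : probability 'rV[R]_d R,
           [/\ (@DPhi R d 0%:E +oo%E f1 `&` @DPhi R d 0%:E +oo%E f2) mu &
               ~ same_measure (Phi 0%:E +oo%E f1 mu) (Phi 0%:E +oo%E f2 mu)]]).

Proof.
pose i0 : 'I_d := Ordinal d_gt0.
pose c : 'rV[R]_d := const_mx 1.
have ci : c 0 i0 = 1 by rewrite mxE.
have tauE (y z : nat -> R) : nondecreasing_seq y -> nondecreasing_seq z ->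
    0 <= y 0%N -> 0 <= z 0%N ->
    (forall M, exists n, M < y n) -> (forall M, exists n, M < z n) ->
    same_measure (tau 0%:E +oo%E (slope y)) (tau 0%:E +oo%E (slope z)).
  by move=> ynd znd y0 z0 yoo zoo B mB; rewrite !tau_slope.
have nd := @shrinking_nondecreasing R.
have s0 (a : R) : 0 <= a -> 0 <= shrinking a 0 by rewrite shrinking0.
have oo := @shrinking_unbounded R.
have cvg0 := shrinking_cvg (lexx (0 : R)).
have cvg1 := shrinking_cvg (ler01 : 0 <= 1 :> R).
split; [exists (slope (shrinking 0)), (slope even_node)|
        exists (slope (shrinking 0)), (slope (shrinking 1))].
- split; [exact: measurable_slope|exact: measurable_slope| |].
    apply: tauE => //; [exact: even_node_nondecreasing|exact: s0|
      exact: even_node_unbounded].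
  move=> D12; have := slope_DPhi c cvg0; rewrite D12.
  by move=> /(DPhi_slope_cvg ci)[l]; exact: even_node_dvg.
- split; [exact: measurable_slope|exact: measurable_slope| |].
    by apply: tauE => //; exact: s0.
  exists (\d_c); split; first by split; [exact: slope_DPhi cvg0|exact: slope_DPhi cvg1].
  have mA l : measurable [set v : 'rV[R]_d | v 0 i0 = l].
    by have := measurable_coord i0 measurableT (measurable_set1 l); rewrite setTI.
  move=> /(_ _ (mA (- 0))); rewrite (Phi_slope ci cvg0) => /esym Phi0.
  have := ae_eq_cst (prob1_ae (mA _) Phi0) (prob1_ae (mA _) (Phi_slope ci cvg1)).
  by rewrite oppr0 => /eqP; rewrite eq_sym oppr_eq0 oner_eq0.
Qed.
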